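(* Let $p\ge 1$ be an integer, let $\mu$ be a fixed real frequency with $\mu\neq 0$, and let $0<h<1$. Consider the $C^{p-1}$ B-splines $\theta^j_p$ of degree $p$ on the uniform grid of size $h$ on the real line, with exactly integrated stiffness and mass entries $A^{j+k}_p$, $B^{j+k}_p$. Let $\omega_h$ be the discrete mode associated with the Bloch wave of frequency $\mu$, that is, $$\omega_h^2=\frac{a(\theta^j_p,u^h)}{b(\theta^j_p,u^h)}=\frac{1}{h^2}\,\frac{A^j_p+2\sum_{k=1}^pA^{j+k}_p\cos(k\mu h)}{B^j_p+2\sum_{k=1}^pB^{j+k}_p\cos(k\mu h)},\qquad u^h=\sum_{l\in\mathbb Z}e^{il\mu h}\theta^l_p .$$ Then, as $h\to0$, $$\omega_h^2-\mu^2=2(-1)^{p+1}\left(\sum_{k=1}^p\left(\frac{k^{2p+2}}{(2p+2)!}A^{j+k}_p+\frac{k^{2p}}{(2p)!}B^{j+k}_p\right)\right)\mu^{2p+2}h^{2p}+\mathcal O(h^{2p+2}).$$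
   Context: Uniform knots $x_j=jh$, $j\in\mathbb Z$, $h>0$, on the real line. The B-splines are defined by the Cox--de Boor recursion: $\theta^j_0=1$ on $[x_j,x_{j+1})$ and $0$ otherwise, and $$\theta^j_p(x)=\frac{x-x_j}{x_{j+p}-x_j}\theta^j_{p-1}(x)+\frac{x_{j+p+1}-x}{x_{j+p+1}-x_{j+1}}\theta^{j+1}_{p-1}(x).$$ The bilinear forms are $a(w,v)=\int w'v'\,dx$ and $b(w,v)=\int wv\,dx$ over the real line (derivatives taken piecewise when $p=1$). The (dimensionless) stiffness and mass entries are $A^{j+k}_p=h\,a(\theta^j_p,\theta^{j+k}_p)$ and $B^{j+k}_p=\frac1h\,b(\theta^j_p,\theta^{j+k}_p)$ for $k\in\mathbb Z$; they do not depend on $h$ or on $j$, are symmetric in $k$ ($A^{j-k}_p=A^{j+k}_p$, $B^{j-k}_p=B^{j+k}_p$), and vanish for $|k|>p$. In $e^{il\mu h}$, $i$ is the imaginary unit. The discrete mode $\omega_h$ is determined by $a(\theta^j_p,u^h)-\omega_h^2\,b(\theta^j_p,u^h)=0$ (this is the discrete Helmholtz equation tested with $\theta^j_p$). *)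

(* Defs.v *)
(* Stdlib reals with Coquelicot. *)
From Stdlib Require Import Reals ZArith.
From Coquelicot Require Import Coquelicot.
Open Scope R_scope.

Definition knot (h : R) (j : Z) : R := IZR j * h.

Fixpoint bspline (h : R) (p : nat) (j : Z) (x : R) : R :=
  match p with
  | O => if Rle_dec (knot h j) x then
           if Rlt_dec x (knot h (j + 1)) then 1 else 0
         else 0
  | S q =>
      (x - knot h j) / (knot h (j + Z.of_nat p) - knot h j)
        * bspline h q j x
      + (knot h (j + Z.of_nat p + 1) - x)
          / (knot h (j + Z.of_nat p + 1) - knot h (j + 1))
        * bspline h q (j + 1) x
  end.

Definition int_line (f : R -> R) : R :=
  RInt_gen f (Rbar_locally m_infty) (Rbar_locally p_infty).

(* [Derive] is total.  For continuous piecewise polynomials it is the classical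
   derivative away from the kinks, and its values at the (locally finitely
   many) kinks do not affect the integral. *)
Definition form_a (w v : R -> R) : R := int_line (fun x => Derive w x * Derive v x).
Definition form_b (w v : R -> R) : R := int_line (fun x => w x * v x).

(* Real first argument, complex-valued second argument: differentiation and
   integration of complex-valued functions of a real variable are
   componentwise. *)
Definition form_aC (w : R -> R) (v : R -> C) : C :=
  (form_a w (fun x => Re (v x)), form_a w (fun x => Im (v x))).
Definition form_bC (w : R -> R) (v : R -> C) : C :=
  (form_b w (fun x => Re (v x)), form_b w (fun x => Im (v x))).

(* A^{j+k}_p and B^{j+k}_p, computed on the grid of size h. *)
Definition stiffness (h : R) (p : nat) (j k : Z) : R :=
  h * form_a (bspline h p j) (bspline h p (j + k)).
Definition mass (h : R) (p : nat) (j k : Z) : R :=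
  / h * form_b (bspline h p j) (bspline h p (j + k)).

Definition expi (t : R) : C := (cos t, sin t).

Definition sumZ (f : Z -> R) : R :=
  Series (fun n => f (Z.of_nat n)) + Series (fun n => f (- Z.of_nat (S n))%Z).
Definition sumZC (f : Z -> C) : C :=
  (sumZ (fun l => Re (f l)), sumZ (fun l => Im (f l))).

(* For h > 0 the sum has only finitely many nonzero terms at each x. *)
Definition bloch_wave (h : R) (p : nat) (mu : R) (x : R) : C :=
  sumZC (fun l => (expi (IZR l * mu * h) * RtoC (bspline h p l x))%C).

Definition discrete_mode (h : R) (p : nat) (mu w : R) : Prop :=
  forall j : Z,
    (form_aC (bspline h p j) (bloch_wave h p mu)
     - RtoC (w ^ 2) * form_bC (bspline h p j) (bloch_wave h p mu) = 0)%C.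

(* Main.v *)
Require Import Defs.
From Stdlib Require Import Reals ZArith Lra Lia FunctionalExtensionality.
From Coquelicot Require Import Coquelicot.
Open Scope R_scope.

(** On a cell of the grid the Bloch wave is, up to a unimodular factor and
    conjugation, the function [u t = sum_m e^(i m th) piece_m t] of the cell
    variable [t], between [0] and [1], where [th = mu h] and
    [piece_0], ..., [piece_p] are the polynomial pieces of one B-spline.  Folding the integrals over the line
    onto this cell gives the symbols of the two matrices as energies,
    [A th = int |u'|^2] and [B th = int |u|^2] ([gram_symbol]), and it gives
    [A th / h] and [h B th] times [e^(i j th)] for the two forms tested with the
    B-spline of index [j] ([form_aC_bloch], [form_bC_bloch]).  So the discrete
    mode satisfies [omega^2 = A th / (h^2 B th)], provided that [B th] does not
    vanish.  Now [B th = 0] would make [u] vanish on the cell; differentiating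
    [u] lowers the degree and multiplies by [1 - e^(i th)], and this leads down
    to degree [0], or else to the partition of unity, a contradiction in both
    cases ([energy_pos]).

    For the order of convergence, write [v t = e^(i th t) u t].  This function
    is periodic, with derivative [w = v'], and
    [A th - th^2 B th = int (|w|^2 + 2 th Im (v conj w))].  Since [w] has mean
    zero, [v] may be replaced by [v - v 0], which is bounded by [w], so the
    difference is quadratic in [w] ([periodic_defect_bound]).  Moreover
    [w = O(th^(p+1))]: each component of [w] vanishes somewhere in the cell by Rolle,
    and the derivative of [w] is [th] times similar defects of degrees [p] and [p - 1]
    ([dtwisted_order]).  Thus [A th - th^2 B th = O(th^(2p+2))].

    The left-hand side is also a finite combination of cosines with an explicit
    Taylor expansion in [th^2].  By the bound just found, its coefficients up to
    [th^(2p)] vanish, and the next one is the constant of the theorem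
    ([energy_defect_expansion]).  Division by [h^2 B th], where
    [B th = 1 + O(th^2)], gives the claim. *)

(** * The polynomial pieces of a uniform B-spline *)
(** [piece p m] is the polynomial that coincides on the cell
    from [x_(j+m)] to [x_(j+m+1)] with the B-spline starting at the knot [x_j], in
    the cell variable [t = x/h - (j+m)].  It is a polynomial in [t] over the whole
    line, so that it can be differentiated at the two ends of the cell too. *)
Fixpoint piece (p : nat) (m : Z) (t : R) : R :=
  match p with
  | O => if Z.eq_dec m 0 then 1 else 0
  | S q =>
      (t + IZR m) / INR (S q) * piece q m t
      + (INR (S q) + 1 - t - IZR m) / INR (S q) * piece q (m - 1) t
  end.

(** The derivative of [piece p m], given by the difference rule for B-splines. *)
Definition dpiece (p : nat) (m : Z) (t : R) : R :=
  match p with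
  | O => 0
  | S q => piece q m t - piece q (m - 1) t
  end.

Lemma piece_S q m t :
  piece (S q) m t = (t + IZR m) / INR (S q) * piece q m t
      + (INR (S q) + 1 - t - IZR m) / INR (S q) * piece q (m - 1) t.
Proof. reflexivity. Qed.

Lemma INR_S_pos q : 0 < INR (S q).
Proof. apply lt_0_INR; lia. Qed.

(** What the product rule needs in order to pass the difference rule from
    degree [q] to degree [q + 1]: the recursion formula for the pieces of
    degree [q - 1] appears twice, shifted by one cell. *)
Lemma dpiece_recursion q m t :
  (t + IZR m) * dpiece q m t + (INR (S q) + 1 - t - IZR m) * dpiece q (m - 1) t
  = INR q * (piece q m t - piece q (m - 1) t).
Proof.
destruct q as [|r].
- simpl; ring.
- pose proof (INR_S_pos r).
  unfold dpiece; rewrite !piece_S.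
  rewrite (S_INR (S r)), !minus_IZR.
  field; lra.
Qed.

Lemma piece_derive p m t : is_derive (piece p m) t (dpiece p m t).
Proof.
revert m; induction p as [|q IH]; intros m.
- apply (is_derive_const (if Z.eq_dec m 0 then 1 else 0) t).
- pose proof (INR_S_pos q) as Hq.
  assert (E : dpiece (S q) m t
    = / INR (S q) * piece q m t + (t + IZR m) / INR (S q) * dpiece q m t
      + (- / INR (S q) * piece q (m - 1) t
         + (INR (S q) + 1 - t - IZR m) / INR (S q) * dpiece q (m - 1) t)).
  { pose proof (dpiece_recursion q m t) as H.
    change (dpiece (S q) m t) with (piece q m t - piece q (m - 1) t).
    set (d := dpiece q m t) in *; set (d' := dpiece q (m - 1) t) in *.
    set (a := piece q m t) in *; set (a' := piece q (m - 1) t) in *.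
    transitivity ((a - a' + ((t + IZR m) * d + (INR (S q) + 1 - t - IZR m) * d'))
                  / INR (S q)); [|field; lra].
    rewrite H, S_INR. rewrite S_INR in Hq; field; lra. }
  rewrite E; clear E.
  change (is_derive (fun t => (t + IZR m) / INR (S q) * piece q m t
    + (INR (S q) + 1 - t - IZR m) / INR (S q) * piece q (m - 1) t) t
    (/ INR (S q) * piece q m t + (t + IZR m) / INR (S q) * dpiece q m t
      + (- / INR (S q) * piece q (m - 1) t
         + (INR (S q) + 1 - t - IZR m) / INR (S q) * dpiece q (m - 1) t))).
  clear Hq; generalize (INR (S q)) as c; intros c.
  apply (is_derive_plus (fun t => (t + IZR m) / c * piece q m t)
    (fun t => (c + 1 - t - IZR m) / c * piece q (m - 1) t)).
  + apply (is_derive_mult (fun t => (t + IZR m) / c) (piece q m));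
      [auto_derive; [trivial | unfold Rdiv; ring] | apply IH | intros; apply Rmult_comm].
  + apply (is_derive_mult (fun t => (c + 1 - t - IZR m) / c)
             (piece q (m - 1)));
      [auto_derive; [trivial | unfold Rdiv; ring] | apply IH | intros; apply Rmult_comm].
Qed.

Lemma piece_support p m t : (m < 0 \/ Z.of_nat p < m)%Z -> piece p m t = 0.
Proof.
revert m; induction p as [|q IH]; intros m Hm.
- simpl; destruct (Z.eq_dec m 0); [lia | reflexivity].
- rewrite piece_S, (IH m) by lia.
  destruct (Z.eq_dec m (Z.of_nat (S q))) as [->|Hne]; [lia|].
  rewrite (IH (m - 1)%Z) by lia; ring.
Qed.

Lemma dpiece_support p m t : (m < 0 \/ Z.of_nat p < m)%Z -> dpiece p m t = 0.
Proof.
destruct p as [|q]; intros Hm; simpl; trivial.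
rewrite !piece_support by lia; ring.
Qed.

(** Continuity of the B-spline at the knots.  It starts at degree 1, where it
    is checked by hand, and the recursion preserves it. *)
Lemma piece_match q m : piece (S q) m 1 = piece (S q) (m + 1) 0.
Proof.
revert m; induction q as [|q IH]; intros m.
- simpl.
  destruct (Z.eq_dec m 0) as [->|H0]; simpl; [lra|].
  destruct (Z.eq_dec (m - 1) 0) as [H1|H1].
  + replace m with 1%Z by lia; simpl; lra.
  + destruct (Z.eq_dec (m + 1) 0) as [H2|H2].
    * replace m with (-1)%Z by lia; simpl; lra.
    * destruct (Z.eq_dec (m + 1 - 1) 0); [lia|lra].
- rewrite (piece_S (S q) m), (piece_S (S q) (m + 1)), (IH m), (IH (m - 1)%Z).
  replace (m - 1 + 1)%Z with m by lia; replace (m + 1 - 1)%Z with m by lia.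
  rewrite plus_IZR. unfold Rdiv; ring.
Qed.

Lemma piece_continuous p m t : continuous (piece p m) t.
Proof. apply (ex_derive_continuous (V := R_NormedModule)); eexists; apply piece_derive. Qed.

Lemma dpiece_continuous p m t : continuous (dpiece p m) t.
Proof.
destruct p as [|q]; [apply continuous_const|].
apply (continuous_minus (piece q m) (piece q (m - 1))); apply piece_continuous.
Qed.

Lemma bspline_piece h p j n x : 0 < h ->
  IZR n * h <= x < (IZR n + 1) * h ->
  bspline h p j x = piece p (n - j) (x / h - IZR n).
Proof.
intros Hh Hx; revert j; induction p as [|q IH]; intros j.
- simpl; unfold knot; rewrite plus_IZR.
  destruct (Z.eq_dec (n - j) 0) as [E|E].
  + replace j with n by lia.
    destruct (Rle_dec (IZR n * h) x); [|lra].
    destruct (Rlt_dec x ((IZR n + 1) * h)); lra.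
  + destruct (Z_lt_le_dec n j) as [Hlt|Hle].
    * assert (IZR n + 1 <= IZR j) by (rewrite <- plus_IZR; apply IZR_le; lia).
      destruct (Rle_dec (IZR j * h) x); trivial; nra.
    * assert (IZR j + 1 <= IZR n) by (rewrite <- plus_IZR; apply IZR_le; lia).
      destruct (Rle_dec (IZR j * h) x); trivial.
      destruct (Rlt_dec x ((IZR j + 1) * h)); trivial; nra.
- cbn [bspline]; rewrite piece_S, IH, IH.
  replace (n - (j + 1))%Z with (n - j - 1)%Z by lia.
  unfold knot; rewrite !plus_IZR, minus_IZR, <- INR_IZR_INZ.
  pose proof (INR_S_pos q).
  f_equal; f_equal; field; repeat split; try lra; nra.
Qed.

Lemma cell_exists h x : 0 < h -> exists n : Z, IZR n * h <= x < (IZR n + 1) * h.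
Proof.
intros Hh; destruct (archimed (x / h)) as [H1 H2].
exists (up (x / h) - 1)%Z; rewrite minus_IZR.
replace x with (x / h * h) at 2 3 by (field; lra); nra.
Qed.

Lemma bspline_outside h p j x : 0 < h ->
  x < IZR j * h \/ (IZR j + INR p + 1) * h < x -> bspline h p j x = 0.
Proof.
intros Hh Hx; destruct (cell_exists h x Hh) as [n Hn].
rewrite (bspline_piece h p j n x Hh Hn); apply piece_support.
destruct Hx as [Hx|Hx]; [left|right].
- assert (IZR n < IZR j) by nra. apply lt_IZR in H; lia.
- assert (IZR j + INR p < IZR n) by nra.
  rewrite INR_IZR_INZ, <- plus_IZR in H; apply lt_IZR in H; lia.
Qed.

(** * Finite sums and sums over the integers *)

Lemma sum_rev n (f : nat -> R) :
  sum_f_R0 (fun i => f (n - i)%nat) n = sum_f_R0 f n.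
Proof.
induction n as [|n IH]; trivial.
rewrite decomp_sum by lia; simpl pred; rewrite (tech5 f n), <- IH.
replace (S n - 0)%nat with (S n) by lia. simpl Nat.sub. ring.
Qed.

Lemma sum_n_m_from_1 (f : nat -> R) q :
  sum_n_m f 1 (S q) = sum_f_R0 (fun k => f (S k)) q.
Proof. rewrite <- sum_n_m_S, <- sum_n_Reals; reflexivity. Qed.

Lemma sum_n_m_1_S (f : nat -> R) q :
  sum_n_m f 1 (S q) = sum_n_m f 1 q + f (S q).
Proof. rewrite sum_n_Sm by lia; reflexivity. Qed.

(** Raising [P] by one creates, on the right, one new product for each lag [k];
    together these products are, in the opposite order, the cross terms that
    the new term creates in the squares on the left. *)
Lemma toeplitz_form_sum (a : Z -> R) (th : R) P :
  (forall z, (z < 0)%Z -> a z = 0) ->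
  sum_f_R0 (fun m => cos (INR m * th) * a (Z.of_nat m)) P ^ 2
  + sum_f_R0 (fun m => sin (INR m * th) * a (Z.of_nat m)) P ^ 2
  = sum_f_R0 (fun m => a (Z.of_nat m) * a (Z.of_nat m)) P
    + 2 * sum_n_m (fun k => cos (INR k * th)
        * sum_f_R0 (fun m => a (Z.of_nat m) * a (Z.of_nat m - Z.of_nat k)%Z) P) 1 P.
Proof.
intros Ha; induction P as [|P IH].
- rewrite sum_n_m_zero by lia. change (@zero R_AbelianMonoid) with 0.
  cbn [sum_f_R0]. change (INR 0) with 0.
  rewrite Rmult_0_l, cos_0, sin_0; ring.
- rewrite !(tech5 _ P), (sum_n_m_ext _ (fun k =>
    plus (cos (INR k * th)
      * sum_f_R0 (fun m => a (Z.of_nat m) * a (Z.of_nat m - Z.of_nat k)%Z) P)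
    (cos (INR k * th) * (a (Z.of_nat (S P)) * a (Z.of_nat (S P) - Z.of_nat k)%Z))))
    by (intros k; rewrite tech5; apply Rmult_plus_distr_l).
  rewrite sum_n_m_plus.
  change (@plus R_AbelianMonoid) with Rplus.
  rewrite sum_n_m_1_S.
  rewrite (sum_eq (fun m => a (Z.of_nat m) * a (Z.of_nat m - Z.of_nat (S P))%Z)
     (fun _ => 0)) by (intros i Hi; rewrite (Ha (_ - _)%Z) by lia; ring).
  rewrite sum_cte, Rmult_0_l, Rmult_0_r, Rplus_0_r.
  rewrite sum_n_m_from_1.
  set (A := a (Z.of_nat (S P))).
  assert (E : sum_f_R0 (fun k => cos (INR (S k) * th) * (A * a (Z.of_nat (S P) - Z.of_nat (S k))%Z)) P
    = A * (cos (INR (S P) * th) * sum_f_R0 (fun m => cos (INR m * th) * a (Z.of_nat m)) P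
           + sin (INR (S P) * th) * sum_f_R0 (fun m => sin (INR m * th) * a (Z.of_nat m)) P)).
  { rewrite <- sum_rev, !scal_sum, <- plus_sum, scal_sum.
    apply sum_eq; intros i Hi.
    replace (Z.of_nat (S P) - Z.of_nat (S (P - i)))%Z with (Z.of_nat i) by lia.
    replace (INR (S (P - i)) * th) with (INR (S P) * th - INR i * th)
      by (rewrite !S_INR, minus_INR by lia; ring).
    rewrite cos_minus; ring. }
  rewrite E; clear E.
  set (c := sum_f_R0 (fun m => cos (INR m * th) * a (Z.of_nat m)) P) in *.
  set (s := sum_f_R0 (fun m => sin (INR m * th) * a (Z.of_nat m)) P) in *.
  set (X := sum_n_m _ _ _) in *. set (Y := sum_f_R0 _ _) in *.
  pose proof (sin2_cos2 (INR (S P) * th)) as H; unfold Rsqr in H.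
  set (cc := cos _) in *; set (ss := sin _) in *.
  replace ((c + cc * A) ^ 2 + (s + ss * A) ^ 2)
    with (c ^ 2 + s ^ 2 + 2 * A * (cc * c + ss * s) + (ss * ss + cc * cc) * A * A) by ring.
  rewrite IH, H; ring.
Qed.

Lemma is_series_finite (a : nat -> R) N :
  (forall n, (N < n)%nat -> a n = 0) -> is_series a (sum_f_R0 a N).
Proof.
intros Ha; change (is_lim_seq (sum_n a) (sum_f_R0 a N)).
apply is_lim_seq_ext_loc with (u := fun _ => sum_f_R0 a N);
  [|apply is_lim_seq_const].
exists N; intros n Hn; rewrite sum_n_Reals.
induction Hn as [|n Hn IH]; trivial.
rewrite tech5, (Ha (S n)) by lia; lra.
Qed.

Definition eventually_zero (f : Z -> R) := exists N : Z, forall l, (N < Z.abs l)%Z -> f l = 0.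

Lemma sumZ_succ f : eventually_zero f -> sumZ (fun l => f (l + 1)%Z) = sumZ f.
Proof.
intros [N HN].
assert (E1 : ex_series (fun n => f (Z.of_nat n))).
{ eexists; apply (is_series_finite _ (Z.to_nat N)); intros n Hn; apply HN; lia. }
assert (E2 : ex_series (fun n => f (- Z.of_nat n)%Z)).
{ eexists; apply (is_series_finite _ (Z.to_nat N)); intros n Hn; apply HN; lia. }
unfold sumZ.
assert (E3 : ex_series (fun n => f (- Z.of_nat (S n))%Z)) by apply (ex_series_incr_1 (fun n => f (- Z.of_nat n)%Z)), E2.
rewrite (Series_incr_1 _ E1).
rewrite (Series_ext (fun n => f (- Z.of_nat (S n) + 1)%Z) (fun n => f (- Z.of_nat n)%Z))
  by (intros n; f_equal; lia).
rewrite (Series_incr_1 _ E2).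
rewrite (Series_ext (fun n => f (Z.of_nat n + 1)%Z) (fun n => f (Z.of_nat (S n))%Z))
  by (intros n; f_equal; lia).
simpl (- Z.of_nat 0)%Z; simpl (Z.of_nat 0); ring.
Qed.

Lemma eventually_zero_shift f n : eventually_zero f -> eventually_zero (fun l => f (l + n)%Z).
Proof. intros [N HN]; exists (N + Z.abs n)%Z; intros l Hl; apply HN; lia. Qed.

Lemma sumZ_ext f g : (forall l, f l = g l) -> sumZ f = sumZ g.
Proof. intros H; unfold sumZ; f_equal; apply Series_ext; intros; apply H. Qed.

Lemma sumZ_shift f n : eventually_zero f -> sumZ (fun l => f (l + n)%Z) = sumZ f.
Proof.
revert f.
assert (H : forall k f, eventually_zero f -> sumZ (fun l => f (l + Z.of_nat k)%Z) = sumZ f).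
{ induction k as [|k IH]; intros f Hf.
  - apply sumZ_ext; intros; f_equal; lia.
  - rewrite <- (IH f Hf), <- (sumZ_succ (fun l => f (l + Z.of_nat k)%Z))
      by now apply eventually_zero_shift.
    apply sumZ_ext; intros; f_equal; lia. }
intros f Hf; destruct (Z_le_gt_dec 0 n) as [Hn|Hn].
- rewrite <- (Z2Nat.id n) by lia; now apply H.
- rewrite <- (H (Z.to_nat (- n)) (fun l => f (l + n)%Z)) by now apply eventually_zero_shift.
  apply sumZ_ext; intros; f_equal; lia.
Qed.

(** The window is brought to [-p .. 0] by a shift, so that the half-series over
    the nonnegative integers keeps the single term of index [0]. *)
Lemma sumZ_window f n p :
  (forall l, (l < n - Z.of_nat p \/ n < l)%Z -> f l = 0) ->
  sumZ f = sum_f_R0 (fun m => f (n - Z.of_nat m)%Z) p.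
Proof.
intros Hf.
rewrite <- (sumZ_shift f n) by (exists (Z.abs n + Z.of_nat p)%Z; intros l Hl; apply Hf; lia).
unfold sumZ.
rewrite (is_series_unique _ _ (is_series_finite _ 0
  (fun k (Hk : (0 < k)%nat) => Hf (Z.of_nat k + n)%Z ltac:(lia)))).
destruct p as [|q].
- rewrite (is_series_unique _ _ (is_series_finite (fun k => f (- Z.of_nat (S k) + n)%Z) 0
    ltac:(intros; apply Hf; lia))).
  cbn [sum_f_R0]; rewrite (Hf (- Z.of_nat 1 + n)%Z) by lia.
  rewrite Rplus_0_r; f_equal; lia.
- rewrite (is_series_unique _ _ (is_series_finite (fun k => f (- Z.of_nat (S k) + n)%Z) q
    ltac:(intros; apply Hf; lia))).
  rewrite (decomp_sum _ (S q)) by lia; simpl pred; f_equal.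
  + simpl; f_equal; lia.
  + apply sum_eq; intros; f_equal; lia.
Qed.

(** * Integrals of functions given cell by cell *)
(** The values at the knots are left free: a B-spline of degree 1 has no
    derivative there, and integrals do not see them. *)
Definition cellwise (h : R) (G : Z -> R -> R) (f : R -> R) : Prop :=
  forall n x, IZR n * h < x < (IZR n + 1) * h -> f x = G n (x / h - IZR n).

Definition outside_zero (h : R) (p : nat) (j : Z) (f : R -> R) : Prop :=
  forall x, x < IZR j * h \/ (IZR j + INR p + 1) * h < x -> f x = 0.

Lemma continuous_ex_RInt (g : R -> R) a b :
  (forall t, continuous g t) -> ex_RInt g a b.
Proof. intros Hg; apply (ex_RInt_continuous (V := R_CompleteNormedModule)); auto. Qed.

Lemma cellwise_is_RInt h G f n :
  0 < h -> cellwise h G f -> (forall t, continuous (G n) t) ->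
  is_RInt f (IZR n * h) ((IZR n + 1) * h) (h * RInt (G n) 0 1).
Proof.
intros Hh Hf Hc.
assert (E0 : / h * (IZR n * h) + - IZR n = 0) by (field; lra).
assert (E1 : / h * ((IZR n + 1) * h) + - IZR n = 1) by (field; lra).
assert (H : is_RInt (fun y => scal (/ h) (G n (/ h * y + - IZR n)))
              (IZR n * h) ((IZR n + 1) * h) (RInt (G n) 0 1)).
{ apply (is_RInt_comp_lin (G n)).
  rewrite E0, E1.
  apply (RInt_correct (G n)), continuous_ex_RInt, Hc. }
apply (is_RInt_scal _ _ _ h) in H.
apply (is_RInt_ext _ _ _ _ _) with (2 := H).
intros x; rewrite Rmin_left, Rmax_right by nra; intros Hx.
rewrite (Hf n x Hx); unfold scal; simpl; unfold mult; simpl.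
rewrite <- Rmult_assoc, Rinv_r, Rmult_1_l by lra.
f_equal; unfold Rdiv; ring.
Qed.

Lemma cellwise_is_RInt_cells h G f j p :
  0 < h -> cellwise h G f -> (forall n t, continuous (G n) t) ->
  is_RInt f (IZR j * h) ((IZR j + INR p + 1) * h)
    (h * sum_f_R0 (fun m => RInt (G (j + Z.of_nat m)%Z) 0 1) p).
Proof.
intros Hh Hf Hc; induction p as [|p IH].
- simpl; rewrite Z.add_0_r, Rplus_0_r; now apply cellwise_is_RInt.
- rewrite tech5, Rmult_plus_distr_l.
  apply (is_RInt_Chasles f _ _ _ _ _ IH).
  pose proof (cellwise_is_RInt h G f (j + Z.of_nat (S p)) Hh Hf (Hc _)) as H.
  rewrite plus_IZR, <- INR_IZR_INZ in H; rewrite S_INR in H |- *.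
  replace (IZR j + INR p + 1) with (IZR j + (INR p + 1)) by ring; exact H.
Qed.

Lemma is_RInt_zero_ext f a b : a <= b -> (forall x, a < x < b -> f x = 0) -> is_RInt f a b 0.
Proof.
intros Hab Hf.
apply is_RInt_ext with (f := fun _ => 0).
- intros x; rewrite Rmin_left, Rmax_right by lra; intros; now rewrite Hf.
- pose proof (is_RInt_const a b 0) as H; unfold scal in H; simpl in H.
  unfold mult in H; simpl in H; now rewrite Rmult_0_r in H.
Qed.

Lemma int_line_cellwise h G f j p :
  0 < h -> cellwise h G f -> (forall n t, continuous (G n) t) ->
  outside_zero h p j f ->
  int_line f = h * sum_f_R0 (fun m => RInt (G (j + Z.of_nat m)%Z) 0 1) p.
Proof.
intros Hh Hf Hc Hout; unfold int_line.
apply (is_RInt_gen_unique (V := R_CompleteNormedModule)).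
pose proof (cellwise_is_RInt_cells h G f j p Hh Hf Hc) as H.
set (I := h * _) in *.
pose proof (pos_INR p) as Hp.
intros P HP; unfold filtermapi.
apply Filter_prod with (Q := fun a => a < IZR j * h)
  (R := fun b => (IZR j + INR p + 1) * h < b).
- now exists (IZR j * h).
- now exists ((IZR j + INR p + 1) * h).
- intros a b Ha Hb; exists I; split; [|now apply locally_singleton].
  simpl; replace I with (0 + I + 0) by ring.
  apply (is_RInt_Chasles f _ ((IZR j + INR p + 1) * h)).
  + apply (is_RInt_Chasles f _ (IZR j * h)); trivial.
    apply is_RInt_zero_ext; [lra|]; intros; apply Hout; lra.
  + apply is_RInt_zero_ext; [lra|]; intros; apply Hout; lra.
Qed.

Lemma bspline_cellwise h p j : 0 < h ->
  cellwise h (fun n => piece p (n - j)) (bspline h p j).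
Proof. intros Hh n x Hx; apply bspline_piece; lra. Qed.

Lemma cellwise_derive h G G' f :
  0 < h -> cellwise h G f ->
  (forall n t, is_derive (G n) t (G' n t)) ->
  cellwise h (fun n t => / h * G' n t) (Derive f).
Proof.
intros Hh Hf HG n x Hx; apply is_derive_unique.
apply is_derive_ext_loc with (f := fun x => G n (x / h - IZR n)).
- assert (Hpos : 0 < Rmin (x - IZR n * h) ((IZR n + 1) * h - x))
    by (apply Rmin_glb_lt; lra).
  exists (mkposreal _ Hpos); intros y Hy; symmetry; apply Hf.
  apply Rabs_def2 in Hy; simpl in Hy; unfold minus, plus, opp in Hy; simpl in Hy.
  pose proof (Rmin_l (x - IZR n * h) ((IZR n + 1) * h - x)).
  pose proof (Rmin_r (x - IZR n * h) ((IZR n + 1) * h - x)). lra.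
- apply (is_derive_comp (G n) (fun x => x / h - IZR n)); [apply HG|].
  auto_derive; [trivial|]; field; lra.
Qed.

Lemma derive_outside_zero h p j f :
  outside_zero h p j f -> outside_zero h p j (Derive f).
Proof.
intros Hf x Hx; apply is_derive_unique.
apply is_derive_ext_loc with (f := fun _ => 0); [|apply (is_derive_const 0 x)].
destruct Hx as [Hx|Hx].
- assert (Hpos : 0 < IZR j * h - x) by lra.
  exists (mkposreal _ Hpos); intros y Hy; symmetry; apply Hf; left.
  apply Rabs_def2 in Hy; simpl in Hy; unfold minus, plus, opp in Hy; simpl in Hy; lra.
- assert (Hpos : 0 < x - (IZR j + INR p + 1) * h) by lra.
  exists (mkposreal _ Hpos); intros y Hy; symmetry; apply Hf; right.
  apply Rabs_def2 in Hy; simpl in Hy; unfold minus, plus, opp in Hy; simpl in Hy; lra.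
Qed.

(** * Gram entries of a family of pieces and their symbol *)

Definition supported (p : nat) (psi : Z -> R -> R) : Prop :=
  forall m t, (m < 0 \/ Z.of_nat p < m)%Z -> psi m t = 0.

(** With [psi] the pieces of a B-spline, or their derivatives, [gram p psi k] is
    the inner product over the line of this function and its translate by [k]
    cells, folded onto a single cell. *)
Definition gram (p : nat) (psi : Z -> R -> R) (k : Z) : R :=
  sum_f_R0 (fun m => RInt (fun t => psi (Z.of_nat m) t * psi (Z.of_nat m - k)%Z t) 0 1) p.

Definition stencil (p : nat) (g : Z -> R) (psi : Z -> R -> R) (t : R) : R :=
  sum_f_R0 (fun m => g (Z.of_nat m) * psi (Z.of_nat m) t) p.

Definition cosZ (th : R) (m : Z) : R := cos (IZR m * th).
Definition sinZ (th : R) (m : Z) : R := sin (IZR m * th).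

(** The integral over one cell of the squared modulus of
    [sum_m e^(i m th) psi_m], the Bloch wave on that cell up to a unimodular
    factor and conjugation. *)
Definition energy (p : nat) (psi : Z -> R -> R) (th : R) : R :=
  RInt (fun t => stencil p (cosZ th) psi t ^ 2 + stencil p (sinZ th) psi t ^ 2) 0 1.

Lemma continuous_sum (F : nat -> R -> R) n t :
  (forall m, continuous (F m) t) -> continuous (fun t => sum_f_R0 (fun m => F m t) n) t.
Proof.
intros HF; induction n as [|n IH]; simpl; [apply HF|].
apply (continuous_plus (fun t => sum_f_R0 (fun m => F m t) n) (F (S n))); auto.
Qed.

Lemma RInt_sum (F : nat -> R -> R) n a b :
  (forall m t, continuous (F m) t) ->
  RInt (fun t => sum_f_R0 (fun m => F m t) n) a b
  = sum_f_R0 (fun m => RInt (F m) a b) n.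
Proof.
intros HF; induction n as [|n IH]; trivial.
simpl; rewrite <- IH; apply (RInt_plus (V := R_CompleteNormedModule));
  apply continuous_ex_RInt; [|apply HF].
intros t; apply continuous_sum; auto.
Qed.

Lemma RInt_scal_R (f : R -> R) c a b :
  (forall t, continuous f t) -> RInt (fun t => c * f t) a b = c * RInt f a b.
Proof. intros Hf; apply (RInt_scal (V := R_CompleteNormedModule)), continuous_ex_RInt, Hf. Qed.

Lemma continuous_scal_R (f : R -> R) c t :
  continuous f t -> continuous (fun t => c * f t) t.
Proof. apply (continuous_scal_r c f). Qed.

Lemma continuous_mult_R (f g : R -> R) t :
  continuous f t -> continuous g t -> continuous (fun t => f t * g t) t.
Proof. exact (@continuous_mult _ R_AbsRing f g t). Qed.

Lemma continuous_plus_R (f g : R -> R) t :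
  continuous f t -> continuous g t -> continuous (fun t => f t + g t) t.
Proof. exact (@continuous_plus _ _ R_NormedModule f g t). Qed.

Lemma continuous_minus_R (f g : R -> R) t :
  continuous f t -> continuous g t -> continuous (fun t => f t - g t) t.
Proof. exact (@continuous_minus _ _ R_NormedModule f g t). Qed.

(** Driven by the syntax of the goal, because trying the closure lemmas in turn
    makes unification unfold the real operations. *)
Ltac continuous_R :=
  lazymatch goal with
  | |- continuous (fun t => @?f t + @?g t) _ => apply (continuous_plus_R f g)
  | |- continuous (fun t => @?f t - @?g t) _ => apply (continuous_minus_R f g)
  | |- continuous (fun t => @?f t * @?g t) _ => apply (continuous_mult_R f g)
  | |- continuous (fun _ => ?c) ?t => exact (continuous_const c t)
  end.

Lemma stencil_continuous p g psi t :
  (forall m t, continuous (psi m) t) -> continuous (stencil p g psi) t.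
Proof.
intros H; apply (continuous_sum (fun m t => g (Z.of_nat m) * psi (Z.of_nat m) t)).
intros m; apply continuous_scal_R, H.
Qed.

Lemma energy_integrand_continuous p psi th t :
  (forall m t, continuous (psi m) t) ->
  continuous (fun t => stencil p (cosZ th) psi t ^ 2 + stencil p (sinZ th) psi t ^ 2) t.
Proof.
intros H; simpl.
repeat continuous_R; now apply stencil_continuous.
Qed.

(** The symbol (cosine series) of the Gram entries is an integral of a square:
    this is [toeplitz_form_sum] under the integral sign. *)
Lemma gram_symbol p psi th :
  supported p psi -> (forall m t, continuous (psi m) t) ->
  gram p psi 0 + 2 * sum_n_m (fun k => gram p psi (Z.of_nat k) * cos (INR k * th)) 1 p
  = energy p psi th.
Proof.
intros Hs Hc; unfold energy.
assert (Hg : forall k, gram p psi k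
  = RInt (fun t => sum_f_R0 (fun m => psi (Z.of_nat m) t * psi (Z.of_nat m - k)%Z t) p) 0 1).
{ intros k; symmetry.
  apply (RInt_sum (fun m t => psi (Z.of_nat m) t * psi (Z.of_nat m - k)%Z t)).
  intros; now apply continuous_mult_R. }
assert (Hgc : forall k t, continuous (fun t =>
   sum_f_R0 (fun m => psi (Z.of_nat m) t * psi (Z.of_nat m - k)%Z t) p) t).
{ intros; apply (continuous_sum (fun m t => psi (Z.of_nat m) t * psi (Z.of_nat m - k)%Z t)).
  intros; now apply continuous_mult_R. }
rewrite (RInt_ext _ (fun t =>
  sum_f_R0 (fun m => psi (Z.of_nat m) t * psi (Z.of_nat m - 0)%Z t) p
  + 2 * sum_n_m (fun k => cos (INR k * th) *
     sum_f_R0 (fun m => psi (Z.of_nat m) t * psi (Z.of_nat m - Z.of_nat k)%Z t) p) 1 p)).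
2:{ intros t _.
  rewrite (sum_eq _ (fun m => psi (Z.of_nat m) t * psi (Z.of_nat m) t))
    by (intros; now rewrite Z.sub_0_r).
  rewrite <- (toeplitz_form_sum (fun m => psi m t) th p) by (intros; apply Hs; lia).
  unfold stencil, cosZ, sinZ.
  f_equal; f_equal; apply sum_eq; intros; now rewrite INR_IZR_INZ. }
destruct p as [|q].
- rewrite !sum_n_m_zero by lia; change (@zero R_AbelianMonoid) with 0.
  rewrite Hg, Rmult_0_r, Rplus_0_r; apply RInt_ext; intros t _.
  rewrite sum_n_m_zero by lia; change (@zero R_AbelianMonoid) with 0; lra.
- rewrite sum_n_m_from_1.
  set (T := fun k t => sum_f_R0 (fun m => psi (Z.of_nat m) t * psi (Z.of_nat m - k)%Z t) (S q)) in *.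
  rewrite (RInt_ext _ (fun t => T 0%Z t + 2 * sum_f_R0 (fun k => cos (INR (S k) * th) * T (Z.of_nat (S k)) t) q))
    by (intros t _; now rewrite sum_n_m_from_1).
  assert (Hk : forall k t, continuous (fun t => cos (INR (S k) * th) * T (Z.of_nat (S k)) t) t)
    by (intros; apply continuous_scal_R, Hgc).
  assert (Hk' : forall t, continuous (fun t => sum_f_R0 (fun k => cos (INR (S k) * th) * T (Z.of_nat (S k)) t) q) t)
    by (intros; apply (continuous_sum (fun k t => cos (INR (S k) * th) * T (Z.of_nat (S k)) t)); auto).
  rewrite (RInt_plus (V := R_CompleteNormedModule) (T 0%Z) (fun t => 2 * _)).
  2:{ apply continuous_ex_RInt, Hgc. }
  2:{ apply continuous_ex_RInt; intros; now apply continuous_scal_R. }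
  rewrite RInt_scal_R by trivial.
  rewrite (RInt_sum (fun k t => cos (INR (S k) * th) * T (Z.of_nat (S k)) t)) by trivial.
  rewrite (Hg 0%Z). change (@plus R_CompleteNormedModule) with Rplus.
  f_equal; f_equal; apply sum_eq; intros k _.
  rewrite Hg, RInt_scal_R by apply Hgc; apply Rmult_comm.
Qed.

Lemma int_line_gram h p psi j k f g c :
  0 < h -> (forall m t, continuous (psi m) t) ->
  cellwise h (fun n t => c * psi (n - j)%Z t) f -> outside_zero h p j f ->
  cellwise h (fun n t => c * psi (n - (j + k))%Z t) g ->
  int_line (fun x => f x * g x) = h * c ^ 2 * gram p psi k.
Proof.
intros Hh Hc Hf Hout Hg.
rewrite (int_line_cellwise h
  (fun n t => c ^ 2 * (psi (n - j)%Z t * psi (n - (j + k))%Z t)) _ j p); trivial.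
- rewrite Rmult_assoc; f_equal; unfold gram; rewrite scal_sum.
  apply sum_eq; intros m _.
  rewrite RInt_scal_R by (intros; now apply continuous_mult_R).
  rewrite Rmult_comm; do 2 f_equal.
  replace (j + Z.of_nat m - j)%Z with (Z.of_nat m) by lia.
  now replace (j + Z.of_nat m - (j + k))%Z with (Z.of_nat m - k)%Z by lia.
- intros n x Hx; rewrite (Hf n x Hx), (Hg n x Hx); ring.
- intros; apply continuous_scal_R; now apply continuous_mult_R.
- intros x Hx; rewrite Hout by trivial; ring.
Qed.

(** * Bilinear forms against a Bloch wave *)

Lemma superposition_cellwise h p (g : Z -> R) : 0 < h ->
  cellwise h (fun n => stencil p (fun m => g (n - m)%Z) (piece p))
    (fun x => sumZ (fun l => g l * bspline h p l x)).
Proof.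
intros Hh n x Hx.
rewrite (sumZ_ext _ (fun l => g l * piece p (n - l) (x / h - IZR n)))
  by (intros l; rewrite (bspline_cellwise h p l Hh n x Hx); reflexivity).
rewrite (sumZ_window _ n p) by (intros l Hl; rewrite piece_support by lia; ring).
apply sum_eq; intros m _; do 2 f_equal; lia.
Qed.

Lemma is_derive_sum (F : nat -> R -> R) (F' : nat -> R) n t :
  (forall m, is_derive (F m) t (F' m)) ->
  is_derive (fun t => sum_f_R0 (fun m => F m t) n) t (sum_f_R0 F' n).
Proof.
intros HF; induction n as [|n IH]; simpl; [apply HF|].
apply (is_derive_plus (fun t => sum_f_R0 (fun m => F m t) n) (F (S n))); auto.
Qed.

Lemma stencil_derive p g t :
  is_derive (stencil p g (piece p)) t (stencil p g (dpiece p) t).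
Proof.
apply (is_derive_sum (fun m t => g (Z.of_nat m) * piece p (Z.of_nat m) t)
  (fun m => g (Z.of_nat m) * dpiece p (Z.of_nat m) t)).
intros m; apply (is_derive_scal (piece p (Z.of_nat m))), piece_derive.
Qed.

(** The phase [phi] covers with real numbers the two components of
    [e^(i n th)]: the real part at [phi = 0] and the imaginary part at
    [phi = - PI / 2]; adding [PI / 2] to [phi] multiplies by [i]. *)
Definition wave (phi th : R) (n : Z) : R := cos (phi + IZR n * th).

(** Folding the line onto one cell replaces the single compactly supported
    factor [f] by the conjugate of the quasi-periodic wave itself.  Hence the
    result is the energy of the wave, times the phase of the test function. *)
Lemma int_line_wave h p psi j f u c phi th :
  0 < h -> (forall m t, continuous (psi m) t) ->
  cellwise h (fun n t => c * psi (n - j)%Z t) f -> outside_zero h p j f ->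
  cellwise h (fun n t => c * stencil p (fun m => wave phi th (n - m)) psi t) u ->
  int_line (fun x => f x * u x) = h * c ^ 2 * (wave phi th j * energy p psi th).
Proof.
intros Hh Hc Hf Hout Hu.
rewrite (int_line_cellwise h
  (fun n t => c ^ 2 * (psi (n - j)%Z t * stencil p (fun m => wave phi th (n - m)) psi t)) _ j p); trivial.
2:{ intros n x Hx; rewrite (Hf n x Hx), (Hu n x Hx); ring. }
2:{ intros; apply continuous_scal_R, continuous_mult_R; [apply Hc|now apply stencil_continuous]. }
2:{ intros x Hx; rewrite Hout by trivial; ring. }
rewrite (sum_eq _ (fun m => RInt (fun t => psi (Z.of_nat m) t *
   stencil p (fun m' => wave phi th (j + Z.of_nat m - m')) psi t) 0 1 * c ^ 2)).
2:{ intros m _.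
    rewrite RInt_scal_R by (intros; apply continuous_mult_R; [apply Hc|now apply stencil_continuous]).
    rewrite Rmult_comm; f_equal.
    apply RInt_ext; intros t _; now replace (j + Z.of_nat m - j)%Z with (Z.of_nat m) by lia. }
rewrite <- scal_sum, Rmult_assoc; do 2 f_equal.
rewrite <- (RInt_sum (fun m t => psi (Z.of_nat m) t *
   stencil p (fun m' => wave phi th (j + Z.of_nat m - m')) psi t))
  by (intros; apply continuous_mult_R; [apply Hc|now apply stencil_continuous]).
unfold energy; rewrite <- RInt_scal_R by (intros; now apply energy_integrand_continuous).
apply RInt_ext; intros t _.
set (C := stencil p (cosZ th) psi t). set (S := stencil p (sinZ th) psi t).
set (al := phi + IZR j * th).
assert (E1 : forall m : nat, stencil p (fun m' => wave phi th (j + Z.of_nat m - m')) psi t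
   = cos (al + IZR (Z.of_nat m) * th) * C + sin (al + IZR (Z.of_nat m) * th) * S).
{ intros m; unfold C, S, stencil; rewrite !scal_sum, <- plus_sum.
  apply sum_eq; intros i _; unfold wave, cosZ, sinZ.
  replace (phi + IZR (j + Z.of_nat m - Z.of_nat i) * th)
    with (al + IZR (Z.of_nat m) * th - IZR (Z.of_nat i) * th)
    by (unfold al; rewrite minus_IZR, plus_IZR; ring).
  rewrite cos_minus; ring. }
rewrite (sum_eq _ (fun m => cosZ th (Z.of_nat m) * psi (Z.of_nat m) t * (cos al * C + sin al * S)
    + sinZ th (Z.of_nat m) * psi (Z.of_nat m) t * (cos al * S - sin al * C))).
2:{ intros m _; rewrite E1, cos_plus, sin_plus; unfold cosZ, sinZ; ring. }
rewrite plus_sum, <- !scal_sum.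
change (sum_f_R0 (fun m => cosZ th (Z.of_nat m) * psi (Z.of_nat m) t) p) with C.
change (sum_f_R0 (fun m => sinZ th (Z.of_nat m) * psi (Z.of_nat m) t) p) with S.
change (wave phi th j) with (cos al).
match goal with |- ?a = ?b => change (@eq R a b) end; ring.
Qed.

Lemma wave_sin th n : wave (- (PI / 2)) th n = sinZ th n.
Proof.
unfold wave, sinZ; rewrite cos_plus, cos_neg, sin_neg, cos_PI2, sin_PI2; ring.
Qed.

Lemma wave_cos th n : wave 0 th n = cosZ th n.
Proof. unfold wave, cosZ; now rewrite Rplus_0_l. Qed.

Lemma bspline_cellwise_unit h p j : 0 < h -> cellwise h (fun n t => 1 * piece p (n - j)%Z t) (bspline h p j).
Proof. intros Hh n x Hx; rewrite Rmult_1_l; now apply bspline_cellwise. Qed.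

Lemma bspline_outside_zero h p j : 0 < h -> outside_zero h p j (bspline h p j).
Proof. intros Hh x Hx; now apply bspline_outside. Qed.

Lemma Derive_bspline_cellwise h p j : 0 < h ->
  cellwise h (fun n t => / h * dpiece p (n - j)%Z t) (Derive (bspline h p j)).
Proof.
intros Hh; apply (cellwise_derive h (fun n => piece p (n - j)) (fun n => dpiece p (n - j))); trivial.
- now apply bspline_cellwise.
- intros; apply piece_derive.
Qed.

Lemma mass_gram h p j k : 0 < h -> mass h p j k = gram p (piece p) k.
Proof.
intros Hh; unfold mass, form_b.
rewrite (int_line_gram h p (piece p) j k _ _ 1); trivial.
- field; lra.
- apply piece_continuous.
- now apply bspline_cellwise_unit.
- now apply bspline_outside_zero.
- now apply bspline_cellwise_unit.
Qed.

Lemma stiffness_gram h p j k : 0 < h -> stiffness h p j k = gram p (dpiece p) k.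
Proof.
intros Hh; unfold stiffness, form_a.
rewrite (int_line_gram h p (dpiece p) j k _ _ (/ h)); trivial.
- field; lra.
- apply dpiece_continuous.
- now apply Derive_bspline_cellwise.
- now apply derive_outside_zero, bspline_outside_zero.
- now apply Derive_bspline_cellwise.
Qed.

Lemma form_b_superposition h p j phi th : 0 < h ->
  form_b (bspline h p j) (fun x => sumZ (fun l => wave phi th l * bspline h p l x))
  = h * (wave phi th j * energy p (piece p) th).
Proof.
intros Hh; unfold form_b.
rewrite (int_line_wave h p (piece p) j _ _ 1 phi th); trivial.
- ring.
- apply piece_continuous.
- now apply bspline_cellwise_unit.
- now apply bspline_outside_zero.
- intros n x Hx; rewrite Rmult_1_l.
  now apply (superposition_cellwise h p (wave phi th) Hh n x).
Qed.

Lemma form_a_superposition h p j phi th : 0 < h ->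
  form_a (bspline h p j) (fun x => sumZ (fun l => wave phi th l * bspline h p l x))
  = / h * (wave phi th j * energy p (dpiece p) th).
Proof.
intros Hh; unfold form_a.
rewrite (int_line_wave h p (dpiece p) j _ _ (/ h) phi th); trivial.
- field; lra.
- apply dpiece_continuous.
- now apply Derive_bspline_cellwise.
- now apply derive_outside_zero, bspline_outside_zero.
- apply (cellwise_derive h (fun n => stencil p (fun m => wave phi th (n - m)) (piece p))
    (fun n => stencil p (fun m => wave phi th (n - m)) (dpiece p))); trivial.
  + now apply superposition_cellwise.
  + intros; apply stencil_derive.
Qed.

Lemma bloch_re h p mu : (fun x => Re (bloch_wave h p mu x))
  = (fun x => sumZ (fun l => wave 0 (mu * h) l * bspline h p l x)).
Proof.
apply functional_extensionality; intros x.
apply sumZ_ext; intros l; rewrite wave_cos; unfold cosZ, Re; simpl.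
rewrite Rmult_assoc; ring.
Qed.

Lemma bloch_im h p mu : (fun x => Im (bloch_wave h p mu x))
  = (fun x => sumZ (fun l => wave (- (PI / 2)) (mu * h) l * bspline h p l x)).
Proof.
apply functional_extensionality; intros x.
apply sumZ_ext; intros l; rewrite wave_sin; unfold sinZ, Im; simpl.
rewrite Rmult_assoc; ring.
Qed.

Lemma form_bC_bloch h p j mu : 0 < h ->
  form_bC (bspline h p j) (bloch_wave h p mu)
  = (expi (IZR j * (mu * h)) * RtoC (h * energy p (piece p) (mu * h)))%C.
Proof.
intros Hh; unfold form_bC; rewrite bloch_re, bloch_im, !form_b_superposition by trivial;
rewrite wave_cos, wave_sin.
unfold expi, cosZ, sinZ, Cmult, RtoC; simpl; f_equal; ring.
Qed.

Lemma form_aC_bloch h p j mu : 0 < h ->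
  form_aC (bspline h p j) (bloch_wave h p mu)
  = (expi (IZR j * (mu * h)) * RtoC (/ h * energy p (dpiece p) (mu * h)))%C.
Proof.
intros Hh; unfold form_aC; rewrite bloch_re, bloch_im, !form_a_superposition by trivial;
rewrite wave_cos, wave_sin.
unfold expi, cosZ, sinZ, Cmult, RtoC; simpl; f_equal; ring.
Qed.

(** * The wave with its plane-wave factor removed *)
(** The components of [sum_m e^(i (m + t) th) piece_m t]: multiplying the wave
    by the plane wave [e^(i t th)] turns its quasi-periodicity into
    periodicity. *)
Definition twisted (p : nat) (phi th t : R) : R := stencil p (wave (phi + t * th) th) (piece p) t.

Definition dtwisted (p : nat) (phi th t : R) : R :=
  stencil p (wave (phi + t * th) th) (dpiece p) t + th * twisted p (phi + PI / 2) th t.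

Lemma wave_add phi d th n :
  wave (phi + d) th n = cos d * wave phi th n + sin d * wave (phi + PI / 2) th n.
Proof.
unfold wave.
replace (phi + d + IZR n * th) with (phi + IZR n * th + d) by ring.
replace (phi + PI / 2 + IZR n * th) with (phi + IZR n * th + PI / 2) by ring.
rewrite !cos_plus, cos_PI2, sin_PI2; ring.
Qed.

Lemma stencil_wave_add p psi phi d th t :
  stencil p (wave (phi + d) th) psi t
  = cos d * stencil p (wave phi th) psi t + sin d * stencil p (wave (phi + PI / 2) th) psi t.
Proof.
unfold stencil; rewrite !scal_sum, <- plus_sum.
apply sum_eq; intros m _; rewrite (wave_add phi d); ring.
Qed.

Lemma twisted_add p phi d th t :
  twisted p (phi + d) th t = cos d * twisted p phi th t + sin d * twisted p (phi + PI / 2) th t.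
Proof.
unfold twisted.
replace (phi + d + t * th) with (phi + t * th + d) by ring.
replace (phi + PI / 2 + t * th) with (phi + t * th + PI / 2) by ring.
apply stencil_wave_add.
Qed.

Lemma dtwisted_add p phi d th t :
  dtwisted p (phi + d) th t = cos d * dtwisted p phi th t + sin d * dtwisted p (phi + PI / 2) th t.
Proof.
unfold dtwisted.
replace (phi + d + PI / 2) with (phi + PI / 2 + d) by ring.
rewrite (twisted_add p (phi + PI / 2) d).
replace (phi + d + t * th) with (phi + t * th + d) by ring.
replace (phi + PI / 2 + t * th) with (phi + t * th + PI / 2) by ring.
rewrite stencil_wave_add; ring.
Qed.

Lemma twisted_derive p phi th t : is_derive (twisted p phi th) t (dtwisted p phi th t).
Proof.
unfold dtwisted, twisted, stencil; rewrite scal_sum, <- plus_sum.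
apply (is_derive_sum (fun m t => wave (phi + t * th) th (Z.of_nat m) * piece p (Z.of_nat m) t)
  (fun m => wave (phi + t * th) th (Z.of_nat m) * dpiece p (Z.of_nat m) t
    + wave (phi + PI / 2 + t * th) th (Z.of_nat m) * piece p (Z.of_nat m) t * th)).
intros m; unfold wave.
pose proof (piece_derive p (Z.of_nat m) t) as H.
auto_derive; [repeat split; eexists; exact H|].
replace (Derive (fun x => piece p (Z.of_nat m) x) t) with (dpiece p (Z.of_nat m) t)
  by (symmetry; exact (is_derive_unique _ _ _ H)).
replace (phi + PI / 2 + t * th + IZR (Z.of_nat m) * th)
  with (phi + t * th + IZR (Z.of_nat m) * th + PI / 2) by ring.
rewrite (cos_plus _ (PI / 2)), cos_PI2, sin_PI2; ring.
Qed.

(** Summation by parts moves the difference of the pieces to the weights. *)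
Lemma stencil_dpiece_S q g t :
  stencil (S q) g (dpiece (S q)) t
  = stencil q g (piece q) t - stencil q (fun m => g (m + 1)%Z) (piece q) t.
Proof.
unfold stencil, dpiece.
rewrite (sum_eq _ (fun m => g (Z.of_nat m) * piece q (Z.of_nat m) t
   - g (Z.of_nat m) * piece q (Z.of_nat m - 1) t)) by (intros; ring).
rewrite minus_sum; f_equal.
- rewrite tech5, (piece_support q (Z.of_nat (S q))) by lia; ring.
- rewrite decomp_sum by lia; simpl pred.
  rewrite piece_support by lia; rewrite Rmult_0_r, Rplus_0_l.
  apply sum_eq; intros i _; f_equal; f_equal; lia.
Qed.

Lemma wave_succ phi th n : wave phi th (n + 1) = wave (phi + th) th n.
Proof. unfold wave; rewrite plus_IZR; f_equal; ring. Qed.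

Lemma dtwisted_S q phi th t :
  dtwisted (S q) phi th t
  = th * twisted (S q) (phi + PI / 2) th t + (twisted q phi th t - twisted q (phi + th) th t).
Proof.
unfold dtwisted; rewrite stencil_dpiece_S.
replace (stencil q (fun m => wave (phi + t * th) th (m + 1)) (piece q) t)
  with (twisted q (phi + th) th t); [unfold twisted at 4; lra|].
unfold twisted, stencil; apply sum_eq; intros m _.
rewrite wave_succ; do 2 f_equal; ring.
Qed.

(** The defect [dtwisted] of degree [q + 1] has, up to factors of size [th],
    the defects of degrees [q + 1] and [q] as derivative; this drives the
    induction of [dtwisted_order]. *)
Lemma dtwisted_S_derive q phi th t :
  is_derive (dtwisted (S q) phi th) t
    (th * dtwisted (S q) (phi + PI / 2) th t + (dtwisted q phi th t - dtwisted q (phi + th) th t)).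
Proof.
apply is_derive_ext with (f := fun t =>
  th * twisted (S q) (phi + PI / 2) th t + (twisted q phi th t - twisted q (phi + th) th t)).
{ intros; symmetry; apply dtwisted_S. }
apply (is_derive_plus (fun t => th * twisted (S q) (phi + PI / 2) th t)
  (fun t => twisted q phi th t - twisted q (phi + th) th t)).
- apply (is_derive_scal (twisted (S q) (phi + PI / 2) th)), twisted_derive.
- apply (is_derive_minus (twisted q phi th) (twisted q (phi + th) th)); apply twisted_derive.
Qed.

(** The value at the end of a cell is the value at the start of the next one by
    continuity at the knots, and the plane-wave factor makes up for the
    shift of the weights. *)
Lemma twisted_periodic q phi th : twisted (S q) phi th 1 = twisted (S q) phi th 0.
Proof.
unfold twisted, stencil.
rewrite tech5, (piece_match q (Z.of_nat (S q))), (piece_support (S q) (_ + 1)) by lia.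
rewrite (decomp_sum _ (S q)) by lia; simpl pred.
replace (piece (S q) (Z.of_nat 0) 0) with 0 by
  (change (Z.of_nat 0) with (-1 + 1)%Z; rewrite <- piece_match, piece_support by lia; trivial).
rewrite !Rmult_0_r, Rplus_0_r, Rplus_0_l.
apply sum_eq; intros m _.
rewrite piece_match, Nat2Z.inj_succ; f_equal.
replace (Z.succ (Z.of_nat m)) with (Z.of_nat m + 1)%Z by lia.
rewrite wave_succ; f_equal; ring.
Qed.

(** * Positivity of the mass symbol *)

Lemma piece_partition p t : sum_f_R0 (fun m => piece p (Z.of_nat m) t) p = 1.
Proof.
induction p as [|q IH]; [reflexivity|].
pose proof (INR_S_pos q).
rewrite (sum_eq _ (fun m => (t + IZR (Z.of_nat m)) / INR (S q) * piece q (Z.of_nat m) t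
  + (INR (S q) + 1 - t - IZR (Z.of_nat m)) / INR (S q) * piece q (Z.of_nat m - 1) t))
  by reflexivity.
rewrite plus_sum, tech5, (decomp_sum _ (S q)) by lia; simpl pred.
rewrite (piece_support q (Z.of_nat (S q))), (piece_support q (Z.of_nat 0 - 1)) by lia.
rewrite !Rmult_0_r, Rplus_0_r, Rplus_0_l, <- plus_sum.
refine (eq_trans _ IH); apply sum_eq; intros m _.
replace (Z.of_nat (S m) - 1)%Z with (Z.of_nat m) by lia.
rewrite Nat2Z.inj_succ, succ_IZR; field; lra.
Qed.

Lemma wave_full_turn th phi m : cos th = 1 -> wave phi th (Z.of_nat m) = cos phi.
Proof.
intros Hc.
assert (Hs : sin th = 0) by (pose proof (sin2_cos2 th) as H; unfold Rsqr in H; rewrite Hc in H; nra).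
unfold wave; rewrite <- INR_IZR_INZ.
induction m as [|m IH]; [simpl; f_equal; ring|].
rewrite S_INR; replace (phi + (INR m + 1) * th) with (phi + INR m * th + th) by ring.
rewrite cos_plus, Hc, Hs, IH; ring.
Qed.

(** The wave does not vanish identically.  If it did in degree [q + 1], its
    derivative [(1 - e^(i th)) u_q] would vanish too.  So either [u_q] vanishes,
    which is excluded by induction, or [e^(i th) = 1], and then the wave is the
    sum of all B-splines, which is [1]. *)
Lemma twisted_not_zero p th :
  ~ (forall phi t, 0 < t < 1 -> twisted p phi th t = 0).
Proof.
induction p as [|q IH]; intros H.
- (* At [t = 1/2] this phase compensates the plane-wave factor. *)
  specialize (H (- (/ 2 * th)) (/ 2) ltac:(lra)).
  unfold twisted, stencil, wave in H; simpl in H.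
  replace (- (/ 2 * th) + / 2 * th + 0 * th) with 0 in H by ring.
  rewrite cos_0 in H; lra.
- destruct (Req_dec (cos th) 1) as [Hc|Hc].
  + specialize (H (- (/ 2 * th)) (/ 2) ltac:(lra)).
    unfold twisted, stencil in H.
    rewrite (sum_eq _ (fun m => piece (S q) (Z.of_nat m) (/ 2))) in H.
    * rewrite piece_partition in H; lra.
    * intros m _; rewrite wave_full_turn by trivial.
      replace (- (/ 2 * th) + / 2 * th) with 0 by ring; rewrite cos_0; ring.
  + apply IH; intros phi t Ht.
    assert (D : forall phi, twisted q phi th t = twisted q (phi + th) th t).
    { intros phi'.
      assert (E : dtwisted (S q) phi' th t = 0).
      { rewrite <- (is_derive_unique _ _ _ (twisted_derive (S q) phi' th t)).
        apply is_derive_unique.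
        apply is_derive_ext_loc with (f := fun _ => 0); [|apply (is_derive_const 0 t)].
        assert (Hpos : 0 < Rmin t (1 - t)) by (apply Rmin_glb_lt; lra).
        exists (mkposreal _ Hpos); intros y Hy; symmetry; apply H.
        apply Rabs_def2 in Hy; simpl in Hy; unfold minus, plus, opp in Hy; simpl in Hy.
        pose proof (Rmin_l t (1 - t)); pose proof (Rmin_r t (1 - t)); lra. }
      rewrite dtwisted_S, H in E by trivial; lra. }
    pose proof (D phi) as D1; pose proof (D (phi + PI / 2)) as D2.
    rewrite (twisted_add q phi th) in D1; rewrite (twisted_add q (phi + PI / 2) th) in D2.
    replace (phi + PI / 2 + PI / 2) with (phi + PI) in D2 by field.
    rewrite (twisted_add q phi PI), cos_PI, sin_PI in D2.
    pose proof (COS_bound th); pose proof (sin2_cos2 th) as N; unfold Rsqr in N.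
    set (a := twisted q phi th t) in *; set (b := twisted q (phi + PI / 2) th t) in *.
    set (c := cos th) in *; set (s := sin th) in *.
    (* [2 - 2 c] is the squared modulus of [1 - e^(i th)]. *)
    assert (F : (2 - 2 * c) * a = 0).
    { replace ((2 - 2 * c) * a) with ((1 - c) * (a - c * a - s * b) + s * (b - c * b + s * a)
        + (1 - (s * s + c * c)) * a) by ring. rewrite N.
      replace (a - c * a - s * b) with 0 by lra.
      replace (b - c * b + s * a) with 0 by lra. ring. }
    apply Rmult_integral in F; destruct F; lra.
Qed.

Lemma twisted_square p psi phi th t :
  stencil p (wave phi th) psi t ^ 2 + stencil p (wave (phi + PI / 2) th) psi t ^ 2
  = stencil p (cosZ th) psi t ^ 2 + stencil p (sinZ th) psi t ^ 2.
Proof.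
assert (E : forall phi, stencil p (wave phi th) psi t
  = cos phi * stencil p (cosZ th) psi t - sin phi * stencil p (sinZ th) psi t).
{ intros phi'; unfold stencil; rewrite !scal_sum, <- minus_sum.
  apply sum_eq; intros m _; unfold wave, cosZ, sinZ; rewrite cos_plus; ring. }
rewrite !E, cos_plus, sin_plus, cos_PI2, sin_PI2.
pose proof (sin2_cos2 phi) as N; unfold Rsqr in N.
set (c := cos phi) in *; set (s := sin phi) in *.
set (x := stencil _ _ _ _); set (y := stencil _ _ _ _).
transitivity ((s * s + c * c) * (x ^ 2 + y ^ 2)); [ring|rewrite N; ring].
Qed.

Lemma RInt_nonneg_zero (g : R -> R) :
  (forall t, continuous g t) -> (forall t, 0 <= g t) -> RInt g 0 1 <= 0 ->
  forall t, 0 < t < 1 -> g t = 0.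
Proof.
intros Hc Hp H0.
assert (Ex : forall a b, ex_RInt g a b) by (intros; now apply continuous_ex_RInt).
assert (Hz : forall t, 0 < t < 1 -> RInt g 0 t = 0).
{ intros t Ht.
  pose proof (RInt_Chasles (V := R_CompleteNormedModule) g 0 t 1 (Ex _ _) (Ex _ _)) as E.
  change (RInt g 0 t + RInt g t 1 = RInt g 0 1) in E.
  pose proof (RInt_ge_0 g 0 t ltac:(lra) (Ex _ _) (fun x _ => Hp x)).
  pose proof (RInt_ge_0 g t 1 ltac:(lra) (Ex _ _) (fun x _ => Hp x)). lra. }
intros t Ht.
assert (D : is_derive (fun t => RInt g 0 t) t (g t)).
{ apply (is_derive_RInt g _ 0); [|apply Hc].
  apply filter_forall; intros; apply (RInt_correct (V := R_CompleteNormedModule)), Ex. }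
rewrite <- (is_derive_unique _ _ _ D); apply is_derive_unique.
apply is_derive_ext_loc with (f := fun _ => 0); [|apply (is_derive_const 0 t)].
assert (Hpos : 0 < Rmin t (1 - t)) by (apply Rmin_glb_lt; lra).
exists (mkposreal _ Hpos); intros y Hy; symmetry; apply Hz.
apply Rabs_def2 in Hy; simpl in Hy; unfold minus, plus, opp in Hy; simpl in Hy.
pose proof (Rmin_l t (1 - t)); pose proof (Rmin_r t (1 - t)); lra.
Qed.

(** A continuous nonnegative function of zero integral vanishes, against
    [twisted_not_zero]. *)
Lemma energy_pos p th : 0 < energy p (piece p) th.
Proof.
apply Rnot_le_lt; intros H.
apply (twisted_not_zero p th); intros phi t Ht.
assert (E := RInt_nonneg_zero _ (fun t => energy_integrand_continuous p (piece p) th t (piece_continuous p))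
  ltac:(intros; simpl; nra) H t Ht); simpl in E.
pose proof (twisted_square p (piece p) (phi + t * th) th t) as F.
unfold twisted; simpl in F; nra.
Qed.

Lemma energy_0 p : energy p (piece p) 0 = 1.
Proof.
unfold energy; rewrite (RInt_ext _ (fun _ => 1)).
- rewrite RInt_const; change ((1 - 0) * 1 = 1); ring.
- intros t _; unfold stencil, cosZ, sinZ.
  rewrite (sum_eq _ (fun m => piece p (Z.of_nat m) t))
    by (intros; rewrite Rmult_0_r, cos_0; ring).
  rewrite piece_partition, (sum_eq _ (fun _ => 0)) by (intros; rewrite Rmult_0_r, sin_0; ring).
  rewrite sum_cte; change (1 ^ 2 + (0 * INR (S p)) ^ 2 = 1); ring.
Qed.

(** * Order of the consistency defect *)
Lemma piece_bounded p : exists K, 0 <= K /\ forall m t, 0 <= t <= 1 -> Rabs (piece p m t) <= K.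
Proof.
induction p as [|q [K [HK IH]]].
- exists 1; split; [lra|]; intros m t _; simpl.
  destruct (Z.eq_dec m 0); [rewrite Rabs_R1|rewrite Rabs_R0]; lra.
- exists (4 * K * (INR (S q) + 2)); split; [pose proof (INR_S_pos q); nra|].
  intros m t Ht; pose proof (INR_S_pos q) as Hq.
  destruct (Z_lt_le_dec m 0) as [Hm|Hm];
    [rewrite piece_support, Rabs_R0 by lia; nra|].
  destruct (Z_lt_le_dec (Z.of_nat (S q)) m) as [Hm'|Hm'];
    [rewrite piece_support, Rabs_R0 by lia; nra|].
  apply IZR_le in Hm, Hm'; rewrite <- INR_IZR_INZ in Hm'.
  rewrite piece_S.
  assert (H1 : 1 <= INR (S q)) by (rewrite S_INR; pose proof (pos_INR q); lra).
  assert (Hi : 0 < / INR (S q) <= 1).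
  { split; [now apply Rinv_0_lt_compat|]; rewrite <- Rinv_1; apply Rinv_le_contravar; lra. }
  assert (B : forall x y, Rabs x <= INR (S q) + 2 -> Rabs y <= K ->
     Rabs (x / INR (S q) * y) <= (INR (S q) + 2) * K).
  { intros x y Hx Hy; unfold Rdiv; rewrite !Rabs_mult, (Rabs_pos_eq (/ _)) by lra.
    apply Rmult_le_compat; trivial; [|apply Rabs_pos|].
    - apply Rmult_le_pos; [apply Rabs_pos|lra].
    - pose proof (Rabs_pos x); nra. }
  eapply Rle_trans; [apply Rabs_triang|].
  apply Rle_trans with ((INR (S q) + 2) * K + (INR (S q) + 2) * K); [|nra].
  apply Rplus_le_compat; apply B; try (apply IH; trivial); apply Rabs_le; lra.
Qed.

Lemma wave_bound phi th n : Rabs (wave phi th n) <= 1.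
Proof. unfold wave; apply Rabs_le; pose proof (COS_bound (phi + IZR n * th)); lra. Qed.

Lemma stencil_bounded p psi K : 0 <= K ->
  (forall m t, 0 <= t <= 1 -> Rabs (psi m t) <= K) ->
  forall phi th t, 0 <= t <= 1 -> Rabs (stencil p (wave phi th) psi t) <= INR (S p) * K.
Proof.
intros HK H phi th t Ht; unfold stencil.
eapply Rle_trans; [apply Rsum_abs|].
eapply Rle_trans; [apply sum_Rle with (Bn := fun _ => K)|rewrite sum_cte; lra].
intros m _; rewrite Rabs_mult, <- (Rmult_1_l K).
apply Rmult_le_compat; try apply Rabs_pos; [apply wave_bound|now apply H].
Qed.

Lemma dtwisted_bounded p : exists K, 0 <= K /\
  forall phi th t, Rabs th <= 1 -> 0 <= t <= 1 -> Rabs (dtwisted p phi th t) <= K.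
Proof.
destruct (piece_bounded p) as [K [HK HB]].
assert (exists K', 0 <= K' /\ forall m t, 0 <= t <= 1 -> Rabs (dpiece p m t) <= K') as [K' [HK' HB']].
{ destruct p as [|q].
  - exists 0; split; [lra|]; intros; simpl; rewrite Rabs_R0; lra.
  - destruct (piece_bounded q) as [L [HL HLB]]; exists (L + L); split; [lra|].
    intros m t Ht; simpl; unfold Rminus; eapply Rle_trans; [apply Rabs_triang|].
    rewrite Rabs_Ropp; apply Rplus_le_compat; now apply HLB. }
pose proof (INR_S_pos p).
exists (INR (S p) * K' + INR (S p) * K); split; [nra|].
intros phi th t Hth Ht; unfold dtwisted.
eapply Rle_trans; [apply Rabs_triang|]; apply Rplus_le_compat.
- now apply stencil_bounded.
- rewrite Rabs_mult, <- (Rmult_1_l (INR (S p) * K)).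
  apply Rmult_le_compat; try apply Rabs_pos; trivial; now apply stencil_bounded.
Qed.

Lemma sin_abs_le th : Rabs (sin th) <= Rabs th.
Proof.
destruct (MVT_gen sin 0 th cos) as [c [_ Hc]].
- intros; auto_derive; trivial; ring.
- intros; apply continuity_sin.
- rewrite sin_0, !Rminus_0_r in Hc; rewrite Hc, Rabs_mult.
  rewrite <- (Rmult_1_l (Rabs th)) at 2.
  apply Rmult_le_compat_r; [apply Rabs_pos|apply Rabs_le; pose proof (COS_bound c); lra].
Qed.

Lemma one_minus_cos_abs_le th : Rabs (1 - cos th) <= Rabs th.
Proof.
destruct (MVT_gen cos 0 th (fun x => - sin x)) as [c [_ Hc]].
- intros; auto_derive; trivial; ring.
- intros; apply continuity_cos.
- rewrite cos_0, !Rminus_0_r in Hc.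
  rewrite <- Rabs_Ropp, Ropp_minus_distr, Hc, Rabs_mult.
  rewrite <- (Rmult_1_l (Rabs th)) at 2.
  apply Rmult_le_compat_r; [apply Rabs_pos|].
  rewrite Rabs_Ropp; apply Rabs_le; pose proof (SIN_bound c); lra.
Qed.

(** The wave approximates a plane wave to order [p]: the derivative [w] of the
    periodic function [twisted] is [O(th^(p+1))].  By Rolle each
    component of [w] vanishes somewhere in the cell, hence it is bounded by its
    own derivative, that is by [th] times the defects of degrees [p] and [p - 1].  Each round of this
    argument gains one power of [th]; in degree [0] there is only one to gain,
    since there [w = i th e^(i t th)]. *)
Lemma dtwisted_order n : forall p, (n <= S p)%nat -> exists K, 0 <= K /\
  forall phi th t, Rabs th <= 1 -> 0 <= t <= 1 ->
    Rabs (dtwisted p phi th t) <= K * Rabs th ^ n.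
Proof.
induction n as [|n IH]; intros p Hn.
- destruct (dtwisted_bounded p) as [K [HK H]]; exists K; split; trivial.
  intros; simpl; rewrite Rmult_1_r; now apply H.
- destruct p as [|q].
  + exists 1; split; [lra|]; intros phi th t Hth Ht.
    replace n with 0%nat by lia.
    unfold dtwisted, twisted, stencil; simpl.
    rewrite !Rmult_0_r, Rplus_0_l, !Rmult_1_r, Rabs_mult, Rmult_1_l.
    rewrite <- (Rmult_1_r (Rabs th)) at 2.
    apply Rmult_le_compat_l; [apply Rabs_pos|apply wave_bound].
  + destruct (IH q ltac:(lia)) as [K [HK HB]], (IH (S q) ltac:(lia)) as [L [HL HLB]].
    exists (L + 2 * K); split; [lra|]; intros phi th t Hth Ht.
    assert (Hpow : 0 <= Rabs th ^ n) by (apply pow_le, Rabs_pos).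
    assert (HD : forall x, 0 <= x <= 1 ->
      Rabs (th * dtwisted (S q) (phi + PI / 2) th x
            + (dtwisted q phi th x - dtwisted q (phi + th) th x))
      <= (L + 2 * K) * Rabs th ^ S n).
    { intros x Hx; rewrite (dtwisted_add q phi th).
      pose proof (HLB (phi + PI / 2) th x Hth Hx) as H1.
      pose proof (HB phi th x Hth Hx) as H2.
      pose proof (HB (phi + PI / 2) th x Hth Hx) as H3.
      pose proof (one_minus_cos_abs_le th) as H4; pose proof (sin_abs_le th) as H5.
      set (A := dtwisted (S q) _ th x) in *; set (B := dtwisted q phi th x) in *.
      set (C := dtwisted q (phi + PI / 2) th x) in *.
      replace (B - (cos th * B + sin th * C)) with ((1 - cos th) * B + - (sin th * C)) by ring.
      eapply Rle_trans; [apply Rabs_triang|].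
      eapply Rle_trans; [apply Rplus_le_compat_l, Rabs_triang|].
      rewrite Rabs_Ropp, !Rabs_mult; simpl.
      pose proof (Rabs_pos th); pose proof (Rabs_pos B); pose proof (Rabs_pos C).
      pose proof (Rabs_pos (1 - cos th)); pose proof (Rabs_pos (sin th)).
      assert (Rabs th * Rabs A <= Rabs th * (L * Rabs th ^ n)) by (apply Rmult_le_compat_l; lra).
      assert (Rabs (1 - cos th) * Rabs B <= Rabs th * (K * Rabs th ^ n)) by (apply Rmult_le_compat; lra).
      assert (Rabs (sin th) * Rabs C <= Rabs th * (K * Rabs th ^ n)) by (apply Rmult_le_compat; lra).
      nra. }
    destruct (MVT_gen (twisted (S q) phi th) 0 1 (dtwisted (S q) phi th)) as [xi [Hxi Exi]].
    { intros; apply twisted_derive. }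
    { intros; apply continuity_pt_filterlim.
      apply (ex_derive_continuous (V := R_NormedModule)); eexists; apply twisted_derive. }
    rewrite twisted_periodic in Exi; rewrite Rmin_left, Rmax_right in Hxi by lra.
    assert (Z : dtwisted (S q) phi th xi = 0) by lra.
    destruct (MVT_gen (dtwisted (S q) phi th) xi t (fun x =>
       th * dtwisted (S q) (phi + PI / 2) th x
            + (dtwisted q phi th x - dtwisted q (phi + th) th x))) as [x [Hx Ex]].
    { intros; apply dtwisted_S_derive. }
    { intros; apply continuity_pt_filterlim.
      apply (ex_derive_continuous (V := R_NormedModule)); eexists; apply dtwisted_S_derive. }
    rewrite Z, Rminus_0_r in Ex; rewrite Ex, Rabs_mult.
    assert (Hx' : 0 <= x <= 1).
    { split; [apply Rle_trans with (2 := proj1 Hx); apply Rmin_glb; lra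
             |apply Rle_trans with (1 := proj2 Hx); apply Rmax_lub; lra]. }
    specialize (HD x Hx').
    assert (Ht1 : Rabs (t - xi) <= 1) by (apply Rabs_le; lra).
    pose proof (Rabs_pos (t - xi)).
    match goal with |- ?a * _ <= _ => pose proof (Rabs_pos (t - xi)); assert (0 <= a) by apply Rabs_pos end.
    nra.
Qed.

Lemma is_derive_oscillation (v w : R -> R) W :
  (forall t, is_derive v t (w t)) ->
  (forall t, 0 <= t <= 1 -> Rabs (w t) <= W) ->
  forall t, 0 <= t <= 1 -> Rabs (v t - v 0) <= W.
Proof.
intros Hd Hw t Ht.
destruct (MVT_gen v 0 t w) as [x [Hx Ex]].
{ intros; apply Hd. }
{ intros; apply continuity_pt_filterlim.
  apply (ex_derive_continuous (V := R_NormedModule)); eexists; apply Hd. }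
rewrite Rmin_left, Rmax_right in Hx by lra.
rewrite Ex, Rabs_mult, Rminus_0_r, (Rabs_pos_eq t) by lra.
specialize (Hw x ltac:(lra)); pose proof (Rabs_pos (w x)); nra.
Qed.

(** With [v = v1 + i v2] periodic and [w = v'], the term linear in [v] is
    [Im (v conj w)].  It does not change when [v] is replaced by [v - v 0],
    because [w] has mean zero; and [v - v 0] is bounded by [w].  So the whole
    integral is quadratic in [w]. *)
Lemma periodic_defect_bound (v1 v2 w1 w2 : R -> R) th W :
  (forall t, is_derive v1 t (w1 t)) -> (forall t, is_derive v2 t (w2 t)) ->
  (forall t, continuous w1 t) -> (forall t, continuous w2 t) ->
  v1 1 = v1 0 -> v2 1 = v2 0 ->
  Rabs th <= 1 ->
  (forall t, 0 <= t <= 1 -> Rabs (w1 t) <= W) ->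
  (forall t, 0 <= t <= 1 -> Rabs (w2 t) <= W) ->
  Rabs (RInt (fun t => w1 t ^ 2 + w2 t ^ 2 + 2 * th * (v2 t * w1 t - v1 t * w2 t)) 0 1)
  <= 6 * W ^ 2.
Proof.
intros Dv1 Dv2 Cw1 Cw2 P1 P2 Hth B1 B2.
(* The difference made by replacing v with v - v 0. *)
set (F := fun t => 2 * th * (v2 0 * w1 t - v1 0 * w2 t)).
assert (HF : is_RInt F 0 1 0).
{ pose proof (is_RInt_derive (fun t => 2 * th * (v2 0 * v1 t - v1 0 * v2 t)) F 0 1) as H.
  cbv beta in H; rewrite P1, P2, minus_eq_zero in H; apply H.
  - intros t _; unfold F.
    apply (is_derive_scal (fun t => v2 0 * v1 t - v1 0 * v2 t)).
    apply (is_derive_minus (fun t => v2 0 * v1 t) (fun t => v1 0 * v2 t)).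
    + now apply (is_derive_scal v1).
    + now apply (is_derive_scal v2).
  - intros t _; unfold F; apply (continuous_scal_R (fun t => v2 0 * w1 t - v1 0 * w2 t)).
    apply (continuous_minus (fun t => v2 0 * w1 t) (fun t => v1 0 * w2 t));
      now apply continuous_scal_R. }
set (H := fun t => w1 t ^ 2 + w2 t ^ 2 + 2 * th * (v2 t * w1 t - v1 t * w2 t)).
assert (CH : forall t, continuous H t).
{ assert (Cv1 : forall t, continuous v1 t) by
    (intros; apply (ex_derive_continuous (V := R_NormedModule)); eexists; apply Dv1).
  assert (Cv2 : forall t, continuous v2 t) by
    (intros; apply (ex_derive_continuous (V := R_NormedModule)); eexists; apply Dv2).
  intros t; unfold H.
  simpl; repeat continuous_R; trivial. }
assert (HI : is_RInt (fun t => H t - F t) 0 1 (RInt H 0 1)).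
{ replace (RInt H 0 1) with (RInt H 0 1 - 0) by ring.
  apply (is_RInt_minus H F); trivial.
  apply (RInt_correct (V := R_CompleteNormedModule)), continuous_ex_RInt, CH. }
rewrite <- (is_RInt_unique _ _ _ _ HI).
apply Rle_trans with ((1 - 0) * (6 * W ^ 2)); [|lra].
apply abs_RInt_le_const; [lra|eexists; exact HI|].
intros t Ht.
pose proof (B1 t Ht) as H1; pose proof (B2 t Ht) as H2.
pose proof (is_derive_oscillation v1 w1 W Dv1 B1 t Ht) as H3.
pose proof (is_derive_oscillation v2 w2 W Dv2 B2 t Ht) as H4.
assert (M : forall x y, Rabs x <= W -> Rabs y <= W -> Rabs (x * y) <= W * W)
  by (intros; rewrite Rabs_mult; apply Rmult_le_compat; trivial; apply Rabs_pos).
pose proof (M _ _ H1 H1) as N1; pose proof (M _ _ H2 H2) as N2.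
pose proof (M _ _ H4 H1) as N3; pose proof (M _ _ H3 H2) as N4.
set (X := (v2 t - v2 0) * w1 t) in *; set (Y := (v1 t - v1 0) * w2 t) in *.
replace (H t - F t) with (w1 t * w1 t + w2 t * w2 t + 2 * (th * (X - Y)))
  by (unfold H, F, X, Y; ring).
assert (Hxy : Rabs (th * (X - Y)) <= 1 * (2 * (W * W))).
{ rewrite Rabs_mult; apply Rmult_le_compat; try apply Rabs_pos; trivial.
  unfold Rminus; eapply Rle_trans; [apply Rabs_triang|]; rewrite Rabs_Ropp; lra. }
apply Rabs_le_between in N1, N2, Hxy; replace (W ^ 2) with (W * W) by ring.
apply Rabs_le; split; lra.
Qed.

(** With [u = e^(- i th t) v], the wave up to conjugation, one has
    [|u'|^2 - th^2 |u|^2 = |v'|^2 + 2 th Im (v conj v')]: the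
    term [th^2 |v|^2] cancels, and what is left is of order twice that of
    [v']. *)
Lemma energy_defect_order p : (1 <= p)%nat -> exists K, forall th, Rabs th <= 1 ->
  Rabs (energy p (dpiece p) th - th ^ 2 * energy p (piece p) th) <= K * (th ^ 2) ^ S p.
Proof.
destruct p as [|q]; [lia|intros _].
destruct (dtwisted_order (S (S q)) (S q) (le_n _)) as [K [HK HB]].
exists (6 * K ^ 2); intros th Hth.
set (p := S q) in *.
assert (E : energy p (dpiece p) th - th ^ 2 * energy p (piece p) th
  = RInt (fun t => dtwisted p 0 th t ^ 2 + dtwisted p (- (PI / 2)) th t ^ 2
      + 2 * th * (twisted p (- (PI / 2)) th t * dtwisted p 0 th t
                  - twisted p 0 th t * dtwisted p (- (PI / 2)) th t)) 0 1).
{ unfold energy.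
  set (P := fun t => stencil p (cosZ th) (dpiece p) t ^ 2 + stencil p (sinZ th) (dpiece p) t ^ 2).
  set (Q := fun t => stencil p (cosZ th) (piece p) t ^ 2 + stencil p (sinZ th) (piece p) t ^ 2).
  assert (H : is_RInt (fun t => P t - th ^ 2 * Q t) 0 1 (RInt P 0 1 - th ^ 2 * RInt Q 0 1)).
  { apply (is_RInt_minus P (fun t => th ^ 2 * Q t)).
    - apply (RInt_correct (V := R_CompleteNormedModule)), continuous_ex_RInt; intros.
      apply energy_integrand_continuous, dpiece_continuous.
    - apply (is_RInt_scal Q 0 1 (th ^ 2)).
      apply (RInt_correct (V := R_CompleteNormedModule)), continuous_ex_RInt; intros.
      apply energy_integrand_continuous, piece_continuous. }
  rewrite <- (is_RInt_unique _ _ _ _ H).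
  apply RInt_ext; intros t _; unfold P, Q.
  rewrite <- (twisted_square p (piece p) (- (PI / 2) + t * th) th t).
  rewrite <- (twisted_square p (dpiece p) (- (PI / 2) + t * th) th t).
  replace (- (PI / 2) + t * th + PI / 2) with (0 + t * th) by ring.
  unfold dtwisted.
  replace (0 + PI / 2) with (- (PI / 2) + PI) by field.
  rewrite (twisted_add p _ PI), cos_PI, sin_PI.
  replace (- (PI / 2) + PI / 2) with 0 by ring.
  change (stencil p (wave (- (PI / 2) + t * th) th) (piece p) t) with (twisted p (- (PI / 2)) th t).
  change (stencil p (wave (0 + t * th) th) (piece p) t) with (twisted p 0 th t).
  match goal with |- ?a = ?b => change (@eq R a b) end; ring. }
rewrite E.
refine (Rle_trans _ _ _ (periodic_defect_bound _ _ _ _ th (K * Rabs th ^ S p)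
  (twisted_derive p 0 th) (twisted_derive p (- (PI / 2)) th) _ _
  (twisted_periodic q 0 th) (twisted_periodic q (- (PI / 2)) th) Hth
  (fun t Ht => HB _ th t Hth Ht) (fun t Ht => HB _ th t Hth Ht)) _).
- intros; apply (ex_derive_continuous (V := R_NormedModule)); eexists; apply dtwisted_S_derive.
- intros; apply (ex_derive_continuous (V := R_NormedModule)); eexists; apply dtwisted_S_derive.
- right; rewrite <- (pow2_abs th), Rpow_mult_distr, <- !pow_mult.
  replace (S p * 2)%nat with (2 * S p)%nat by lia; ring.
Qed.

(** * Taylor expansion of the symbols *)

(** Consecutive Taylor polynomials of the cosine enclose it for [|a| <= 2], so the error is at most the first omitted term; the factorial is
    dropped from the bound. *)
Lemma cos_taylor (n : nat) (a : R) : Rabs a <= 2 ->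
  Rabs (cos a - cos_approx a n) <= (a ^ 2) ^ S n.
Proof.
intros Ha; apply Rabs_le_between in Ha.
set (d := (a ^ 2) ^ S n / INR (fact (2 * S n))).
assert (Hd : 0 <= d <= (a ^ 2) ^ S n).
{ assert (0 <= (a ^ 2) ^ S n) by (apply pow_le; simpl; nra).
  assert (1 <= INR (fact (2 * S n))) by (apply (le_INR 1), lt_O_fact).
  assert (0 < / INR (fact (2 * S n)) <= 1).
  { split; [apply Rinv_0_lt_compat; lra|]; rewrite <- Rinv_1; apply Rinv_le_contravar; lra. }
  unfold d, Rdiv; nra. }
assert (Hs : cos_approx a (S n) = cos_approx a n + (-1) ^ S n * d).
{ unfold cos_approx; rewrite tech5; unfold cos_term at 2, d; now rewrite <- pow_mult. }
assert (B : cos_approx a n <= cos a <= cos_approx a (S n)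
  \/ cos_approx a (S n) <= cos a <= cos_approx a n).
{ destruct (Nat.Even_or_Odd n) as [[m ->]|[m ->]].
  - right; destruct m as [|m].
    + split; [apply (proj1 (pre_cos_bound a 0 (proj1 Ha) (proj2 Ha)))|].
      unfold cos_approx, cos_term; simpl; pose proof (COS_bound a); lra.
    + split.
      * replace (S (2 * S m)) with (2 * S m + 1)%nat by lia.
        apply (proj1 (pre_cos_bound a (S m) (proj1 Ha) (proj2 Ha))).
      * replace (2 * S m)%nat with (2 * (m + 1))%nat by lia.
        apply (proj2 (pre_cos_bound a m (proj1 Ha) (proj2 Ha))).
  - left; split; [apply (proj1 (pre_cos_bound a m (proj1 Ha) (proj2 Ha)))|].
    replace (S (2 * m + 1)) with (2 * (m + 1))%nat by lia.
    apply (proj2 (pre_cos_bound a m (proj1 Ha) (proj2 Ha))). }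
assert (Hsgn : Rabs ((-1) ^ S n * d) = d).
{ rewrite Rabs_mult, pow_1_abs, Rabs_pos_eq; lra. }
apply Rle_trans with d; [|lra]; rewrite <- Hsgn.
set (e := (-1) ^ S n * d) in *; clearbody e.
destruct B as [B|B]; rewrite Hs in B; unfold Rabs; repeat destruct Rcase_abs; lra.
Qed.

(** The coefficient of [(th^2)^i] in the expansion of [sum_k b_k cos (k th)]. *)
Definition moment (b : nat -> R) (P i : nat) : R :=
  (-1) ^ i / INR (fact (2 * i)) * sum_f_R0 (fun k => b k * INR k ^ (2 * i)) P.

Lemma cosine_sum_taylor (b : nat -> R) P N : exists K, forall th, Rabs th * INR P <= 2 ->
  Rabs (sum_f_R0 (fun k => b k * cos (INR k * th)) P
        - sum_f_R0 (fun i => moment b P i * (th ^ 2) ^ i) N) <= K * (th ^ 2) ^ S N.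
Proof.
exists (sum_f_R0 (fun k => Rabs (b k) * (INR k ^ 2) ^ S N) P); intros th Hth.
assert (E : sum_f_R0 (fun i => moment b P i * (th ^ 2) ^ i) N
  = sum_f_R0 (fun k => b k * cos_approx (INR k * th) N) P).
{ clear Hth; unfold moment; induction P as [|P IH].
  - cbn [sum_f_R0]; unfold cos_approx; rewrite scal_sum; apply sum_eq; intros i _.
    unfold cos_term; rewrite Rpow_mult_distr, <- pow_mult; unfold Rdiv; ring.
  - rewrite tech5, <- IH; unfold cos_approx; rewrite scal_sum, <- plus_sum.
    apply sum_eq; intros i _; rewrite tech5.
    unfold cos_term; rewrite Rpow_mult_distr, <- pow_mult; unfold Rdiv; ring. }
rewrite E, <- minus_sum, (Rmult_comm _ ((th ^ 2) ^ S N)), scal_sum.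
eapply Rle_trans; [apply Rsum_abs|]; apply sum_Rle; intros k Hk.
rewrite <- Rmult_minus_distr_l, Rabs_mult, Rmult_assoc, <- Rpow_mult_distr.
apply Rmult_le_compat_l; [apply Rabs_pos|].
rewrite <- Rpow_mult_distr; apply cos_taylor.
rewrite Rabs_mult, (Rabs_pos_eq (INR k)) by apply pos_INR.
apply le_INR in Hk; pose proof (Rabs_pos th); nra.
Qed.

Lemma polynomial_bounded c n : exists M, 0 <= M /\ forall y, 0 <= y <= 1 ->
  Rabs (sum_f_R0 (fun i => c i * y ^ i) n) <= M.
Proof.
exists (sum_f_R0 (fun i => Rabs (c i)) n); split.
- apply cond_pos_sum; intros; apply Rabs_pos.
- intros y Hy; eapply Rle_trans; [apply Rsum_abs|]; apply sum_Rle; intros i _.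
  rewrite Rabs_mult; rewrite <- (Rmult_1_r (Rabs (c i))) at 2.
  apply Rmult_le_compat_l; [apply Rabs_pos|].
  rewrite Rabs_pos_eq by (apply pow_le; lra).
  rewrite <- (pow1 i); apply pow_incr; lra.
Qed.

(** The constant term is the limit at [0], hence zero; dividing by [y] lowers the
    degree and the order together. *)
Lemma polynomial_small_zero n : forall (c : nat -> R) K d, 0 < d ->
  (forall y, 0 < y < d -> Rabs (sum_f_R0 (fun i => c i * y ^ i) n) <= K * y ^ S n) ->
  forall i, (i <= n)%nat -> c i = 0.
Proof.
assert (small : forall a M d, 0 < d -> (forall y, 0 < y < d -> Rabs a <= M * y) -> a = 0).
{ intros a M d Hd H.
  destruct (Req_dec a 0) as [|Ha]; trivial; exfalso.
  apply Rabs_pos_lt in Ha.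
  pose proof (Rabs_pos M).
  set (y := Rmin (d / 2) (Rabs a / (2 * (Rabs M + 1)))).
  assert (Hq : 0 < Rabs a / (2 * (Rabs M + 1))) by (apply Rdiv_lt_0_compat; lra).
  assert (Hy : 0 < y) by (apply Rmin_glb_lt; lra).
  assert (Hy1 := Rmin_l (d / 2) (Rabs a / (2 * (Rabs M + 1)))); fold y in Hy1.
  assert (Hy2 := Rmin_r (d / 2) (Rabs a / (2 * (Rabs M + 1)))); fold y in Hy2.
  specialize (H y ltac:(lra)).
  assert (M * y <= (Rabs M + 1) * (Rabs a / (2 * (Rabs M + 1)))).
  { pose proof (RRle_abs M).
    apply Rle_trans with ((Rabs M + 1) * y); [nra|apply Rmult_le_compat_l; lra]. }
  replace ((Rabs M + 1) * (Rabs a / (2 * (Rabs M + 1)))) with (Rabs a / 2) in H1 by (field; lra).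
  lra. }
induction n as [|n IH]; intros c K d Hd H.
- assert (H0 : c 0%nat = 0).
  { apply (small _ K d Hd); intros y Hy; specialize (H y Hy); simpl in H.
    now rewrite !Rmult_1_r in H. }
  intros i Hi; now replace i with 0%nat by lia.
- destruct (polynomial_bounded (fun i => c (S i)) n) as [M [HM HB]].
  assert (split : forall y, sum_f_R0 (fun i => c i * y ^ i) (S n)
    = c 0%nat + y * sum_f_R0 (fun i => c (S i) * y ^ i) n).
  { intros y; rewrite decomp_sum by lia; simpl pred; rewrite scal_sum; f_equal; [simpl; ring|].
    apply sum_eq; intros; simpl; ring. }
  assert (Hd1 : 0 < Rmin d 1) by (apply Rmin_glb_lt; lra).
  pose proof (Rmin_l d 1) as Hl; pose proof (Rmin_r d 1) as Hr.
  assert (H0 : c 0%nat = 0).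
  { apply (small _ (Rabs K + M) _ Hd1); intros y Hy.
    specialize (H y ltac:(lra)); specialize (HB y ltac:(lra)); rewrite split in H.
    set (R := sum_f_R0 _ n) in *.
    replace (c 0%nat) with (c 0%nat + y * R + - (y * R)) by ring.
    eapply Rle_trans; [apply Rabs_triang|].
    rewrite Rabs_Ropp, Rabs_mult, (Rabs_pos_eq y) by lra.
    assert (Hp : 0 <= y ^ S n <= 1)
      by (split; [apply pow_le; lra|rewrite <- (pow1 (S n)); apply pow_incr; lra]).
    change (y ^ S (S n)) with (y * y ^ S n) in H.
    pose proof (RRle_abs K); pose proof (Rabs_pos K).
    assert (K * (y * y ^ S n) <= Rabs K * y).
    { apply Rle_trans with (Rabs K * (y * y ^ S n)).
      - apply Rmult_le_compat_r; [apply Rmult_le_pos; lra|trivial].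
      - apply Rmult_le_compat_l; trivial; nra. }
    nra. }
  intros [|i] Hi; trivial.
  apply (IH (fun i => c (S i)) K d Hd); [|lia].
  intros y Hy; specialize (H y Hy); rewrite split, H0, Rplus_0_l, Rabs_mult, (Rabs_pos_eq y) in H by lra.
  apply Rmult_le_reg_l with y; [lra|].
  eapply Rle_trans; [exact H|]; right; simpl; ring.
Qed.

(** The entries of both signs of [k] are gathered on [k >= 0]. *)
Definition weight (p : nat) (psi : Z -> R -> R) (k : nat) : R :=
  match k with O => gram p psi 0 | S _ => 2 * gram p psi (Z.of_nat k) end.

Lemma energy_cosine_sum p psi th : (1 <= p)%nat ->
  supported p psi -> (forall m t, continuous (psi m) t) ->
  energy p psi th = sum_f_R0 (fun k => weight p psi k * cos (INR k * th)) p.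
Proof.
intros Hp Hs Hc; rewrite <- (gram_symbol p psi th Hs Hc).
destruct p as [|q]; [lia|].
rewrite sum_n_m_from_1, (decomp_sum _ (S q)) by lia; simpl pred; f_equal.
- simpl; rewrite Rmult_0_l, cos_0; ring.
- rewrite scal_sum; apply sum_eq; intros; unfold weight; ring.
Qed.

Lemma moment_weight p psi i : (1 <= p)%nat -> (1 <= i)%nat ->
  moment (weight p psi) p i
  = 2 * (-1) ^ i * sum_n_m (fun k => INR k ^ (2 * i) / INR (fact (2 * i))
       * gram p psi (Z.of_nat k)) 1 p.
Proof.
intros Hp Hi; destruct p as [|q]; [lia|].
unfold moment; rewrite sum_n_m_from_1, decomp_sum by lia; simpl pred.
change (INR 0) with 0; rewrite (pow_i (2 * i)) by lia.
rewrite Rmult_0_r, Rplus_0_l, !scal_sum.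
apply sum_eq; intros k _; unfold weight, Rdiv; ring.
Qed.

(** The defect has a Taylor polynomial in [th^2] of degree [p + 1] and is
    [O((th^2)^(p+1))] by [energy_defect_order].  Hence all coefficients but the
    last vanish, and the last one is a combination of moments of the Gram
    entries. *)
Lemma energy_defect_expansion p : (1 <= p)%nat ->
  exists K d, 0 < d /\ forall th, Rabs th < d ->
  Rabs (energy p (dpiece p) th - th ^ 2 * energy p (piece p) th
    - 2 * (-1) ^ S p * sum_n_m (fun k =>
         INR k ^ (2 * S p) / INR (fact (2 * S p)) * gram p (dpiece p) (Z.of_nat k)
         + INR k ^ (2 * p) / INR (fact (2 * p)) * gram p (piece p) (Z.of_nat k)) 1 p
      * (th ^ 2) ^ S p) <= K * (th ^ 2) ^ S (S p).
Proof.
intros Hp1.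
destruct (cosine_sum_taylor (weight p (dpiece p)) p (S p)) as [K1 T1].
destruct (cosine_sum_taylor (weight p (piece p)) p p) as [K2 T2].
destruct (energy_defect_order p Hp1) as [K3 T3].
set (al := moment (weight p (dpiece p)) p) in *.
set (be := moment (weight p (piece p)) p) in *.
(* Multiplying the mass symbol by th^2 shifts its coefficients by one. *)
set (c := fun i => match i with O => al O | S i' => al i - be i' end).
assert (Hp : 0 < INR p) by (apply lt_0_INR; lia).
set (d := Rmin 1 (2 / INR p)).
assert (Hd : 0 < d) by (apply Rmin_glb_lt; [lra|apply Rdiv_lt_0_compat; lra]).
assert (Hd1 : forall th, Rabs th < d -> Rabs th <= 1 /\ Rabs th * INR p <= 2).
{ intros th Hth; pose proof (Rmin_l 1 (2 / INR p)); pose proof (Rmin_r 1 (2 / INR p)).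
  fold d in H, H0; split; [lra|].
  replace 2 with (2 / INR p * INR p) by (field; lra).
  apply Rmult_le_compat_r; lra. }
assert (Main : forall th, Rabs th < d ->
  Rabs (energy p (dpiece p) th - th ^ 2 * energy p (piece p) th
     - sum_f_R0 (fun i => c i * (th ^ 2) ^ i) (S p)) <= (K1 + K2) * (th ^ 2) ^ S (S p)).
{ intros th Hth; destruct (Hd1 th Hth) as [_ H2].
  specialize (T1 th H2); specialize (T2 th H2).
  rewrite <- (energy_cosine_sum p _ _ Hp1 (dpiece_support p) (dpiece_continuous p)) in T1.
  rewrite <- (energy_cosine_sum p _ _ Hp1 (piece_support p) (piece_continuous p)) in T2.
  assert (E : sum_f_R0 (fun i => c i * (th ^ 2) ^ i) (S p)
    = sum_f_R0 (fun i => al i * (th ^ 2) ^ i) (S p)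
      - th ^ 2 * sum_f_R0 (fun i => be i * (th ^ 2) ^ i) p).
  { rewrite (decomp_sum _ (S p)), (decomp_sum (fun i => al i * _) (S p)) by lia; simpl pred.
    rewrite scal_sum; unfold Rminus; rewrite Rplus_assoc; f_equal.
    rewrite <- Rminus_def, <- minus_sum; apply sum_eq; intros i _; unfold c.
    change ((th ^ 2) ^ S i) with (th ^ 2 * (th ^ 2) ^ i); ring. }
  rewrite E.
  set (A := energy p (dpiece p) th) in *; set (B := energy p (piece p) th) in *.
  set (X := sum_f_R0 _ (S p)) in *; set (Y := sum_f_R0 _ p) in *.
  replace (A - th ^ 2 * B - (X - th ^ 2 * Y)) with (A - X + - (th ^ 2 * (B - Y))) by ring.
  eapply Rle_trans; [apply Rabs_triang|].
  assert (0 <= th ^ 2) by apply pow2_ge_0.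
  rewrite Rabs_Ropp, Rabs_mult, (Rabs_pos_eq (th ^ 2)), Rmult_plus_distr_r by trivial.
  apply Rplus_le_compat; trivial.
  change ((th ^ 2) ^ S (S p)) with (th ^ 2 * (th ^ 2) ^ S p).
  replace (K2 * (th ^ 2 * (th ^ 2) ^ S p)) with (th ^ 2 * (K2 * (th ^ 2) ^ S p)) by ring.
  now apply Rmult_le_compat_l. }
assert (Zero : forall i, (i <= p)%nat -> c i = 0).
{ apply (polynomial_small_zero p c (K3 + (Rabs (K1 + K2) + Rabs (c (S p)))) (d ^ 2));
    [now apply pow_lt|].
  intros y Hy.
  assert (Hsq : sqrt y ^ 2 = y) by (apply pow2_sqrt; lra).
  assert (Hth : Rabs (sqrt y) < d).
  { rewrite Rabs_pos_eq by apply sqrt_pos.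
    apply Rsqr_incrst_0; [|apply sqrt_pos|lra]; unfold Rsqr; simpl in Hsq, Hy; nra. }
  destruct (Hd1 _ Hth) as [H1 H2].
  assert (H1y : y <= 1).
  { rewrite <- Hsq, <- pow2_abs; simpl; pose proof (Rabs_pos (sqrt y)); nra. }
  specialize (Main _ Hth); specialize (T3 _ H1).
  rewrite Hsq in Main, T3; rewrite tech5 in Main.
  change (y ^ S (S p)) with (y * y ^ S p) in Main.
  assert (Hyp : 0 <= y ^ S p) by (apply pow_le; lra).
  set (f := energy p (dpiece p) (sqrt y) - y * energy p (piece p) (sqrt y)) in *.
  set (X := sum_f_R0 _ p) in *.
  replace X with (f - (f - (X + c (S p) * y ^ S p)) - c (S p) * y ^ S p) by ring.
  unfold Rminus at 1; eapply Rle_trans; [apply Rabs_triang|].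
  unfold Rminus at 1; eapply Rle_trans; [apply Rplus_le_compat_r, Rabs_triang|].
  rewrite !Rabs_Ropp, Rabs_mult, (Rabs_pos_eq (y ^ S p)) by trivial.
  pose proof (RRle_abs (K1 + K2)); pose proof (Rabs_pos (K1 + K2)).
  assert ((K1 + K2) * (y * y ^ S p) <= Rabs (K1 + K2) * y ^ S p).
  { apply Rle_trans with (Rabs (K1 + K2) * (y * y ^ S p)).
    - apply Rmult_le_compat_r; [apply Rmult_le_pos; lra|trivial].
    - apply Rmult_le_compat_l; trivial; nra. }
  lra. }
exists (K1 + K2), d; split; trivial; intros th Hth; specialize (Main th Hth).
rewrite tech5, (sum_eq _ (fun _ => 0)), sum_cte, Rmult_0_l, Rplus_0_l in Main
  by (intros; rewrite Zero by trivial; ring).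
refine (Rle_trans _ _ _ (Req_le _ _ _) Main); do 2 f_equal; f_equal.
unfold c, al, be; rewrite !moment_weight by lia.
rewrite (sum_n_m_plus (G := R_AbelianMonoid)
  (fun k => INR k ^ (2 * S p) / INR (fact (2 * S p)) * gram p (dpiece p) (Z.of_nat k))
  (fun k => INR k ^ (2 * p) / INR (fact (2 * p)) * gram p (piece p) (Z.of_nat k))).
change (@plus R_AbelianMonoid) with Rplus; simpl ((-1) ^ _); ring.
Qed.

(** * The discrete dispersion relation *)

(** The constant term is [1] by the partition of unity. *)
Lemma energy_near_1 p : (1 <= p)%nat ->
  exists K d, 0 < d /\ forall th, Rabs th < d ->
    Rabs (energy p (piece p) th - 1) <= K * th ^ 2 /\ / 2 <= energy p (piece p) th.
Proof.
intros Hp.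
destruct (cosine_sum_taylor (weight p (piece p)) p 0) as [K HK].
assert (Hp' : 0 < INR p) by (apply lt_0_INR; lia).
assert (HB : forall th, Rabs th * INR p <= 2 -> Rabs (energy p (piece p) th - 1) <= K * th ^ 2).
{ assert (Hm : moment (weight p (piece p)) p 0 = 1).
  { specialize (HK 0); rewrite Rabs_R0, Rmult_0_l in HK; specialize (HK ltac:(lra)).
    rewrite <- (energy_cosine_sum p _ _ Hp (piece_support p) (piece_continuous p)), energy_0 in HK.
    simpl in HK; rewrite !Rmult_1_r, !Rmult_0_l, Rmult_0_r in HK.
    pose proof (Rabs_pos (1 - moment (weight p (piece p)) p 0)) as H.
    assert (H0 : Rabs (1 - moment (weight p (piece p)) p 0) = 0) by lra.
    apply Rabs_eq_0 in H0; lra. }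
  intros th Hth; specialize (HK th Hth).
  rewrite <- (energy_cosine_sum p _ _ Hp (piece_support p) (piece_continuous p)) in HK.
  cbn [sum_f_R0] in HK; rewrite Hm, pow_O, Rmult_1_r, pow_1 in HK; exact HK. }
pose proof (Rabs_pos K).
assert (Hd1 : 0 < 2 / INR p) by (apply Rdiv_lt_0_compat; lra).
assert (Hd2 : 0 < / (2 * (Rabs K + 1))) by (apply Rinv_0_lt_compat; lra).
exists K, (Rmin 1 (Rmin (2 / INR p) (/ (2 * (Rabs K + 1))))); split.
{ repeat apply Rmin_glb_lt; lra. }
intros th Hth.
pose proof (Rlt_le_trans _ _ _ Hth (Rmin_l _ _)) as T1.
pose proof (Rlt_le_trans _ _ _ Hth (Rmin_r _ _)) as T.
pose proof (Rlt_le_trans _ _ _ T (Rmin_l _ _)) as T2.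
pose proof (Rlt_le_trans _ _ _ T (Rmin_r _ _)) as T3.
assert (Hb : Rabs (energy p (piece p) th - 1) <= K * th ^ 2).
{ apply HB; replace 2 with (2 / INR p * INR p) by (field; lra).
  apply Rmult_le_compat_r; lra. }
split; trivial.
assert (K * th ^ 2 <= / 2).
{ rewrite <- pow2_abs; pose proof (Rabs_pos th); pose proof (RRle_abs K).
  assert ((Rabs K + 1) * Rabs th <= / 2).
  { replace (/ 2) with ((Rabs K + 1) * / (2 * (Rabs K + 1))) by (field; lra).
    apply Rmult_le_compat_l; lra. }
  assert (Rabs th ^ 2 <= Rabs th) by (simpl; nra).
  assert (0 <= Rabs th ^ 2) by apply pow2_ge_0.
  nra. }
apply Rabs_le_between in Hb; lra.
Qed.

Lemma expi_neq_0 t : expi t <> RtoC 0.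
Proof.
unfold expi, RtoC; intros E; injection E as Hc Hs.
pose proof (sin2_cos2 t) as N; rewrite Hc, Hs in N; unfold Rsqr in N; lra.
Qed.

Lemma discrete_mode_quotient h p mu w : 0 < h -> discrete_mode h p mu w ->
  w ^ 2 = energy p (dpiece p) (mu * h) / (h ^ 2 * energy p (piece p) (mu * h)).
Proof.
intros Hh Hw; specialize (Hw 0%Z).
(* For the test function starting at the knot 0 the phase factor is 1. *)
rewrite form_aC_bloch, form_bC_bloch in Hw by trivial.
pose proof (energy_pos p (mu * h)) as HB.
set (A := energy p (dpiece p) (mu * h)) in *; set (B := energy p (piece p) (mu * h)) in *.
replace (IZR 0 * (mu * h)) with 0 in Hw by ring.
unfold expi in Hw; rewrite cos_0, sin_0 in Hw.
apply (f_equal fst) in Hw.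
assert (H : / h * A = w ^ 2 * (h * B)) by (simpl in Hw; simpl; lra).
replace A with (h * (/ h * A)) by (field; lra).
rewrite H; field; lra.
Qed.

Theorem theorem1 (p : nat) (mu : R) (omega : R -> R) (j : Z)
  (Hp : (1 <= p)%nat) (Hmu : mu <> 0)
  (Homega : forall h : R, 0 < h < 1 -> discrete_mode h p mu (omega h)) :
  (forall h : R, 0 < h < 1 ->
     form_bC (bspline h p j) (bloch_wave h p mu) <> RtoC 0 /\
     RtoC (omega h ^ 2) =
       (form_aC (bspline h p j) (bloch_wave h p mu)
        / form_bC (bspline h p j) (bloch_wave h p mu))%C /\
     mass h p j 0
       + 2 * sum_n_m (fun k => mass h p j (Z.of_nat k) * cos (INR k * mu * h)) 1 p
       <> 0 /\
     omega h ^ 2 =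
       1 / h ^ 2 *
       ((stiffness h p j 0
         + 2 * sum_n_m (fun k => stiffness h p j (Z.of_nat k) * cos (INR k * mu * h)) 1 p)
        / (mass h p j 0
           + 2 * sum_n_m (fun k => mass h p j (Z.of_nat k) * cos (INR k * mu * h)) 1 p)))
  /\
  (* The entries do not depend on the mesh size, so the coefficient is a
     constant: it may be computed on any grid, of size h0. *)
  (forall h0 : R, 0 < h0 ->
     exists K : R, at_right 0 (fun h : R =>
       Rabs (omega h ^ 2 - mu ^ 2
             - 2 * (-1) ^ (p + 1)
               * sum_n_m (fun k =>
                   INR k ^ (2 * p + 2) / INR (fact (2 * p + 2))
                     * stiffness h0 p j (Z.of_nat k)
                   + INR k ^ (2 * p) / INR (fact (2 * p))
                     * mass h0 p j (Z.of_nat k)) 1 p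
               * mu ^ (2 * p + 2) * h ^ (2 * p))
       <= K * h ^ (2 * p + 2))).
Proof.
assert (Hquot := fun h (Hh : 0 < h < 1) =>
  discrete_mode_quotient h p mu (omega h) (proj1 Hh) (Homega h Hh)).
split.
- intros h Hh; assert (Hh0 := proj1 Hh); specialize (Hquot h Hh).
  pose proof (energy_pos p (mu * h)) as HB.
  assert (EM : mass h p j 0
      + 2 * sum_n_m (fun k => mass h p j (Z.of_nat k) * cos (INR k * mu * h)) 1 p
      = energy p (piece p) (mu * h)).
  { rewrite <- (gram_symbol p _ _ (piece_support p) (piece_continuous p)).
    rewrite mass_gram by trivial; f_equal; f_equal; apply sum_n_m_ext; intros k.
    rewrite mass_gram by trivial; now rewrite Rmult_assoc. }
  assert (ES : stiffness h p j 0
      + 2 * sum_n_m (fun k => stiffness h p j (Z.of_nat k) * cos (INR k * mu * h)) 1 p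
      = energy p (dpiece p) (mu * h)).
  { rewrite <- (gram_symbol p _ _ (dpiece_support p) (dpiece_continuous p)).
    rewrite stiffness_gram by trivial; f_equal; f_equal; apply sum_n_m_ext; intros k.
    rewrite stiffness_gram by trivial; now rewrite Rmult_assoc. }
  rewrite EM, ES, form_aC_bloch, form_bC_bloch by trivial.
  set (A := energy p (dpiece p) (mu * h)) in *; set (B := energy p (piece p) (mu * h)) in *.
  assert (HhB : RtoC (h * B) <> RtoC 0).
  { intros E; injection E as E; nra. }
  pose proof (expi_neq_0 (IZR j * (mu * h))) as He.
  repeat split.
  + now apply Cmult_neq_0.
  + replace (/ h * A) with (omega h ^ 2 * (h * B)) by (rewrite Hquot; field; lra).
    rewrite RtoC_mult; field; split; trivial.
  + lra.
  + rewrite Hquot; field; lra.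
- intros h0 Hh0.
  set (c := 2 * (-1) ^ (p + 1) * sum_n_m _ 1 p).
  destruct (energy_defect_expansion p Hp) as [K1 [d1 [Hd1 H1]]].
  destruct (energy_near_1 p Hp) as [K2 [d2 [Hd2 H2]]].
  assert (Ec : c = 2 * (-1) ^ S p * sum_n_m (fun k =>
         INR k ^ (2 * S p) / INR (fact (2 * S p)) * gram p (dpiece p) (Z.of_nat k)
         + INR k ^ (2 * p) / INR (fact (2 * p)) * gram p (piece p) (Z.of_nat k)) 1 p).
  { unfold c; rewrite Nat.add_1_r; f_equal; apply sum_n_m_ext; intros k.
    rewrite stiffness_gram, mass_gram by trivial.
    now replace (2 * S p)%nat with (2 * p + 2)%nat by lia. }
  clearbody c.
  assert (Hmu' : 0 < Rabs mu) by now apply Rabs_pos_lt.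
  assert (Hd : 0 < Rmin 1 (Rmin (d1 / Rabs mu) (d2 / Rabs mu)))
    by (repeat apply Rmin_glb_lt; try apply Rdiv_lt_0_compat; lra).
  exists (2 * (K1 + Rabs c * K2) * mu ^ (2 * p + 4)).
  exists (mkposreal _ Hd); intros h Hball Hpos.
  assert (Hlt : h < Rmin 1 (Rmin (d1 / Rabs mu) (d2 / Rabs mu))).
  { apply Rabs_def2 in Hball; simpl in Hball; unfold minus, plus, opp in Hball; simpl in Hball; lra. }
  pose proof (Rlt_le_trans _ _ _ Hlt (Rmin_l _ _)) as L1.
  pose proof (Rlt_le_trans _ _ _ Hlt (Rmin_r _ _)) as L.
  pose proof (Rlt_le_trans _ _ _ L (Rmin_l _ _)) as L2.
  pose proof (Rlt_le_trans _ _ _ L (Rmin_r _ _)) as L3.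
  assert (Hth : forall d, h < d / Rabs mu -> Rabs (mu * h) < d).
  { intros d Hd'; rewrite Rabs_mult, (Rabs_pos_eq h) by lra.
    replace d with (Rabs mu * (d / Rabs mu)) by (field; lra).
    now apply Rmult_lt_compat_l. }
  specialize (H1 _ (Hth d1 L2)); destruct (H2 _ (Hth d2 L3)) as [H3 H4].
  rewrite <- Ec in H1.
  specialize (Hquot h (conj Hpos L1)).
  set (A := energy p (dpiece p) (mu * h)) in *; set (B := energy p (piece p) (mu * h)) in *.
  set (y := (mu * h) ^ 2) in *.
  assert (Hy : 0 <= y) by apply pow2_ge_0.
  assert (Hyp : 0 <= y ^ S p) by now apply pow_le.
  set (X := omega h ^ 2 - mu ^ 2 - c * mu ^ (2 * p + 2) * h ^ (2 * p)).
  (* From h^2 B omega^2 = A. *)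
  assert (EX : h ^ 2 * B * X = (A - y * B - c * y ^ S p) + c * y ^ S p * (1 - B)).
  { unfold X; rewrite Hquot.
    assert (Eyp : y ^ S p = mu ^ (2 * p + 2) * h ^ (2 * p) * h ^ 2).
    { unfold y; rewrite <- pow_mult, Rpow_mult_distr, Rmult_assoc, <- pow_add.
      now replace (2 * S p)%nat with (2 * p + 2)%nat by lia. }
    rewrite Eyp; unfold y; field; lra. }
  assert (BX : Rabs (h ^ 2 * B * X) <= (K1 + Rabs c * K2) * y ^ S (S p)).
  { rewrite EX; eapply Rle_trans; [apply Rabs_triang|].
    rewrite Rmult_plus_distr_r; apply Rplus_le_compat; trivial.
    rewrite !Rabs_mult, (Rabs_pos_eq (y ^ S p)), Rabs_minus_sym by trivial.
    change (y ^ S (S p)) with (y * y ^ S p).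
    replace (Rabs c * K2 * (y * y ^ S p)) with (Rabs c * y ^ S p * (K2 * y)) by ring.
    apply Rmult_le_compat_l; trivial; apply Rmult_le_pos; trivial; apply Rabs_pos. }
  assert (Hh2 : 0 < h ^ 2) by now apply pow_lt.
  rewrite !Rabs_mult, (Rabs_pos_eq (h ^ 2)), (Rabs_pos_eq B) in BX by lra.
  assert (Ey : y ^ S (S p) = mu ^ (2 * p + 4) * h ^ (2 * p + 2) * h ^ 2).
  { unfold y; rewrite <- pow_mult, Rpow_mult_distr, Rmult_assoc, <- pow_add.
    now replace (2 * S (S p))%nat with (2 * p + 4)%nat by lia;
      replace (2 * p + 2 + 2)%nat with (2 * p + 4)%nat by lia. }
  rewrite Ey in BX.
  apply Rmult_le_reg_l with (h ^ 2 * / 2); [lra|].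
  apply Rle_trans with (h ^ 2 * B * Rabs X).
  + apply Rmult_le_compat_r; [apply Rabs_pos|]; apply Rmult_le_compat_l; lra.
  + eapply Rle_trans; [exact BX|]; right; field.
Qed.
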